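(* For every $\mu>0$ there exists $\bar D>0$ (depending on $\mu$) such that, for every $D\in(0,\bar D]$ and every $\gamma>\max\{4,\;2D+4\sqrt{2}\,D^{1.5}\}$, the system $$ \dot{x}_1(t)=x_2(t),\qquad \dot{x}_2(t)=-\frac{\gamma x_1(t)+|x_2(t)|\,x_2(t)}{\max\{\mu,|x_1(t)|\}}+d(t),\qquad t\ge 0, $$ with state $x=(x_1,x_2)^\top\in\mathbb{R}^2$ and scalar disturbance input $d$, is strongly iISS with input bound $D$; that is, it is integral input-to-state stable (iISS), and it is input-to-state stable (ISS) for the inputs satisfying $\|d\|_\infty\le D$.
   Context: Notation: $\mathbb{R}_+=[0,+\infty)$; $\|\cdot\|$ is the Euclidean norm. For measurable $d:\mathbb{R}_+\to\mathbb{R}$ put $\|d\|_{[0,t)}=\operatorname{ess\,sup}_{s\in[0,t)}|d(s)|$ and $\|d\|_\infty=\|d\|_{[0,+\infty)}$; $\mathcal{L}_\infty^1$ is the set of measurable $d:\mathbb{R}_+\to\mathbb{R}$ with $\|d\|_\infty<+\infty$. A continuous function $\alpha:\mathbb{R}_+\to\mathbb{R}_+$ is of class $\mathcal{K}$ if $\alpha(0)=0$ and it is strictly increasing; it is of class $\mathcal{K}_\infty$ if in addition it is unbounded (increasing to infinity). A continuous function $\beta:\mathbb{R}_+\times\mathbb{R}_+\to\mathbb{R}_+$ is of class $\mathcal{KL}$ if $\beta(\cdot,t)\in\mathcal{K}$ for each fixed $t\ge0$ and $\beta(s,\cdot)$ is decreasing to zero for each fixed $s>0$. The right-hand side of the system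 is locally Lipschitz continuous in $x$; for $x_0\in\mathbb{R}^2$ and $d\in\mathcal{L}_\infty^1$, $x(t,x_0,d)$ denotes the corresponding solution with $x(0)=x_0$. iISS: there exist $\alpha\in\mathcal{K}_\infty$, $\rho\in\mathcal{K}$ and $\beta\in\mathcal{KL}$ such that for all $x_0\in\mathbb{R}^2$ and all $d\in\mathcal{L}_\infty^1$ the solution exists for all $t\ge0$ and $$\alpha(\|x(t,x_0,d)\|)\le\beta(\|x_0\|,t)+\int_0^t\rho(|d(s)|)\,ds\qquad\forall t\ge0.$$ ISS for the inputs satisfying $\|d\|_\infty\le D$: there exist $\beta\in\mathcal{KL}$ and $\rho\in\mathcal{K}$ such that for all $x_0\in\mathbb{R}^2$ and all $d\in\mathcal{L}_\infty^1$ with $\|d\|_\infty\le D$, $$\|x(t,x_0,d)\|\le\beta(\|x_0\|,t)+\rho(\|d\|_{[0,t)})\qquad\forall t\ge0.$$ A system is called strongly iISS if it is iISS and there is a $D>0$ such that it is ISS for the inputs satisfying $\|d\|_\infty\le D$. *)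

(* Defs.v *)
From HB Require Import structures.
From mathcomp Require Import all_boot all_order all_algebra.
From mathcomp Require Import all_classical all_reals all_analysis ess_sup_inf.

Set Implicit Arguments.
Unset Strict Implicit.
Unset Printing Implicit Defensive.

Import Order.TTheory GRing.Theory Num.Theory.
Import numFieldTopology.Exports numFieldNormedType.Exports.

Local Open Scope classical_set_scope.
Local Open Scope ring_scope.

(* Functions on R_+ are represented by functions on R of which only the values
   on [0, +oo[ matter. *)

(* Values in R_+ follow from alpha 0 = 0 and monotonicity. *)
Definition classK (R : realType) (alpha : R -> R) : Prop :=
  [/\ {within `[0, +oo[%classic, continuous alpha},
      alpha 0 = 0
    & forall r s : R, 0 <= r -> r < s -> alpha r < alpha s].

Definition classKoo (R : realType) (alpha : R -> R) : Prop :=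
  classK alpha /\ alpha s @[s --> +oo] --> +oo.

Definition classKL (R : realType) (beta : R -> R -> R) : Prop :=
  [/\ {within [set p : R * R | 0 <= p.1 /\ 0 <= p.2],
        continuous (fun p => beta p.1 p.2)},
      forall t : R, 0 <= t -> classK (beta ^~ t)
    & forall s : R, 0 < s ->
        (forall t u : R, 0 <= t -> t < u -> beta s u < beta s t) /\
        beta s t @[t --> +oo] --> (0 : R)].

(* The library norm on R * R is the maximum norm. *)
Definition enorm (R : realType) (x : R * R) : R :=
  Num.sqrt (x.1 ^+ 2 + x.2 ^+ 2).

(* ess sup of |d| over the interval I; it is -oo when I is null, so that
   [fine] turns it into the conventional 0. *)
Definition essnorm (R : realType) (I : interval R) (d : R -> R) : \bar R :=
  ess_sup (mrestr (@lebesgue_measure R) (measurable_itv I))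
    (fun s => `|d s|%:E).

Definition Linfty (R : realType) (d : R -> R) : Prop :=
  measurable_fun (`[0, +oo[%classic : set R) d /\ (essnorm `[0%R, +oo[ d < +oo)%E.

(* Caratheodory solution on R_+ of x' = f x d, x(0) = x0.  Inputs are merely
   measurable, so the equation is read in integrated form; integrability of
   the right-hand side makes x locally absolutely continuous. *)
Definition is_solution (R : realType) (f : R * R -> R -> R * R)
    (x0 : R * R) (d : R -> R) (x : R -> R * R) : Prop :=
  forall t : R, 0 <= t ->
    [/\ (@lebesgue_measure R).-integrable `[0, t]
          (fun s => ((f (x s) (d s)).1)%:E),
        (@lebesgue_measure R).-integrable `[0, t]
          (fun s => ((f (x s) (d s)).2)%:E)
      & x t = (x0.1 + \int[lebesgue_measure]_(s in `[0, t]) (f (x s) (d s)).1,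
               x0.2 + \int[lebesgue_measure]_(s in `[0, t]) (f (x s) (d s)).2)].

(* In the next two definitions, "the" solution x(., x0, d) (unique when f is
   locally Lipschitz in the state) is required to exist on all of R_+, and the
   estimate is required of every solution. *)
Definition iISS (R : realType) (f : R * R -> R -> R * R) : Prop :=
  exists (alpha rho : R -> R) (beta : R -> R -> R),
    [/\ classKoo alpha, classK rho, classKL beta
      & forall (x0 : R * R) (d : R -> R), Linfty d ->
          (exists x, is_solution f x0 d x) /\
          forall x, is_solution f x0 d x -> forall t : R, 0 <= t ->
            alpha (enorm (x t)) <=
            beta (enorm x0) t
            + \int[lebesgue_measure]_(s in `[0, t]) rho `|d s|].

Definition ISS_bounded (R : realType) (f : R * R -> R -> R * R) (D : R) : Prop :=
  exists (beta : R -> R -> R) (rho : R -> R),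
    [/\ classKL beta, classK rho
      & forall (x0 : R * R) (d : R -> R),
          Linfty d -> (essnorm `[0%R, +oo[ d <= D%:E)%E ->
          (exists x, is_solution f x0 d x) /\
          forall x, is_solution f x0 d x -> forall t : R, 0 <= t ->
            enorm (x t) <= beta (enorm x0) t + rho (fine (essnorm `[0, t[ d))].

Definition strongly_iISS_with (R : realType) (f : R * R -> R -> R * R) (D : R)
    : Prop :=
  iISS f /\ ISS_bounded f D.

Definition sys (R : realType) (mu gamma : R) (x : R * R) (d : R) : R * R :=
  (x.2, - ((gamma * x.1 + `|x.2| * x.2) / Num.max mu `|x.1|) + d).

(* Main.v *)
Require Import Defs.
From HB Require Import structures.
From mathcomp Require Import all_boot all_order all_algebra.
From mathcomp Require Import all_classical all_reals all_analysis ess_sup_inf.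
From mathcomp Require Import ring lra.
Import Order.TTheory GRing.Theory Num.Theory.
Import numFieldTopology.Exports numFieldNormedType.Exports.
Local Open Scope classical_set_scope.
Local Open Scope ring_scope.
Set Implicit Arguments.
Unset Strict Implicit.
Unset Printing Implicit Defensive.

(** In the coordinates X1 = x1 / mu and X2 = x2 / (mu s), where
    s = sqrt (gamma / mu), the system reads
      X1' = s X2,   X2' = s (- (X1 + |X2| X2) / m + d / gamma),
      m = max (1, |X1|).
    The parameters survive only in the time scale s and in the input d / gamma.
    Smallness of the input therefore only concerns D / gamma, and as gamma > 4
    one bound on D, namely 1/320, serves every mu and gamma.

    The energy V = X2^2 + q(X1), with q' = 2 X1 / m, loses 2 s |X2|^3 / m per
    unit of time, which vanishes on the axis X2 = 0.  A cross term repairs this: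
      Z = sqrt V + X1 X2 / (20 (1 + V))
    satisfies, away from the origin,
      Z' <= s (- p(Z) / 160 + 2 |d| / gamma),   p(z) = z^2 / (1 + z^2)
    ([lyap_drift] and [lyap_gain]).  The weight 1 / (1 + V) makes this one
    inequality hold at both scales.  Near the origin the system is an oscillator
    with quadratic damping, so that Z decays like 1/t; far away it is homogeneous
    (X1 of degree 2, X2 of degree 1, time of degree 1) and Z decays at constant
    speed.  That the rate p is bounded is the reason why only small inputs can be
    tolerated for ever, whereas integrable inputs do no harm of any size.

    Both estimates follow because p is nondecreasing.  For iISS,
    y = Z - (2 s / gamma) int |d| satisfies y' <= - (s/160) p(y) where y > 0.
    For ISS with |d| <= delta, half of the decay at level w pays for the input if
    w^2 = 1280 delta / gamma <= 1, and y = Z - w satisfies y' <= - (s/320) p(y)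
    where y > 0.  In both cases y stays below an explicit supersolution
    ([decay]) of y' = - k p(y), which is a KL function of y(0) and t.  Finally Z is
    at most a multiple of the norm of the state, and the norm is at most a
    quadratic polynomial in Z ([scaled_lyap_le], [enorm_le_growth]).

    Inputs are only measurable, so Z is not differentiable in time.  Instead of
    derivatives almost everywhere, one-sided increments are bounded at every
    time: the increment of the input integral is kept as a second infinitesimal
    next to h in first-order expansions ([expands]), and a right slope condition
    at every point is enough to compare functions ([dini_le0]).

    Solutions exist because the substitution of the integrated input turns the
    equation into a Volterra equation with continuous right-hand side, solvable
    by Picard iteration ([volterra_fixpoint]) once the damping is truncated.
    The truncation level grows with time at least as fast as |x2| can, because
    the damping only slows x2 down, so that the truncation is never active
    ([trajectory_exists]). *)

(** * Primitives of locally integrable functions *)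

Section Primitive.
Context {R : realType}.
Notation mu := (@lebesgue_measure R).
Implicit Types f g : R -> R.

(** Zero for t <= 0, which makes primitives continuous on the whole line. *)
Definition prim f (t : R) : R := \int[mu]_(s in `[0, t]) f s.

Definition locint f :=
  forall t : R, 0 <= t -> mu.-integrable `[0, t] (EFin \o f).

Lemma prim_le0 f t : t <= 0 -> prim f t = 0.
Proof.
rewrite le_eqVlt => /predU1P[->|t0]; rewrite /prim.
  by rewrite set_itv1 Rintegral_set1.
by rewrite set_itv_ge ?Rintegral_set0// -leNgt bnd_simp.
Qed.

Lemma locint_itv f a b : locint f -> 0 <= a -> a <= b ->
  mu.-integrable `]a, b] (EFin \o f).
Proof.
move=> lf a0 ab; apply: integrableS (lf b (le_trans a0 ab)) => //.
by apply: subset_itv; rewrite bnd_simp.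
Qed.

Lemma primB f a b : locint f -> 0 <= a -> a <= b ->
  prim f b - prim f a = \int[mu]_(s in `]a, b]) f s.
Proof.
move=> lf a0 ab; rewrite /prim Rintegral_itvB ?bnd_simp//.
exact/lf/(le_trans a0).
Qed.

(** The truncation of f to the nonnegative half-line has the same primitive
    started from a negative a, so that t becomes an interior point. *)
Lemma prim_continuous f : locint f -> continuous (prim f).
Proof.
move=> lf t.
have [a [at_ a0]] : exists a : R, a < t /\ a < 0.
  exists (Num.min t 0 - 1); split.
    by rewrite (@lt_le_trans _ _ (Num.min t 0)) ?ltrBlDr ?ltrDl// ge_min lexx.
  by rewrite (@lt_le_trans _ _ (Num.min t 0)) ?ltrBlDr ?ltrDl// ge_min lexx orbT.
have [b [tb b0]] : exists b : R, t < b /\ 0 < b.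
  exists (Num.max t 0 + 1); split.
    by rewrite (@le_lt_trans _ _ (Num.max t 0)) ?ltrDl// le_max lexx.
  by rewrite (@le_lt_trans _ _ (Num.max t 0)) ?ltrDl// le_max lexx orbT.
have itvI x : `[a, x] `&` `[0, +oo[ = `[0%R, x]%classic :> set R.
  apply/seteqP; split => y /=; rewrite !in_itv/= ?andbT.
    by move=> [/andP[_ ->] ->].
  by move=> /andP[y0 ->]; rewrite y0 (le_trans (ltW a0) y0).
have E : prim f = fun x => parameterized_integral mu a x (f \_ `[0, +oo[).
  apply/funext => x; rewrite /prim /parameterized_integral -itvI.
  by rewrite Rintegral_mkcondr.
have ifa : mu.-integrable `[a, b] (EFin \o (f \_ `[0, +oo[)).
  rewrite -restrict_EFin; apply/integrable_restrict => //.
  by rewrite itvI; exact/lf/ltW.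
have := parameterized_integral_continuous (ltW (lt_trans at_ tb)) ifa.
rewrite -E => /(continuous_within_itvP _ (lt_trans at_ tb))[+ _ _].
by apply; rewrite in_itv/= at_ tb.
Qed.

Lemma locint_continuous f : continuous f -> locint f.
Proof.
move=> cf t t0; apply: continuous_compact_integrable; first exact: segment_compact.
exact: continuous_subspaceT.
Qed.

Lemma locintD f g : locint f -> locint g -> locint (fun s => f s + g s).
Proof. by move=> lf lg t t0; exact: (integrableD _ (lf t t0) (lg t t0)). Qed.

Lemma locint_norm f : locint f -> locint (fun s => `|f s|).
Proof. by move=> lf t t0; exact: integrable_norm (lf t t0). Qed.

Lemma primD f g t : locint f -> locint g -> 
  prim (fun s => f s + g s) t = prim f t + prim g t.
Proof.
move=> lf lg; have [t0|t0] := leP 0 t; last by rewrite !prim_le0 ?addr0 ?ltW.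
by rewrite /prim RintegralD//; [exact: lf|exact: lg].
Qed.

Lemma primZ c f t : locint f -> prim (fun s => c * f s) t = c * prim f t.
Proof.
move=> lf; have [t0|t0] := leP 0 t; last by rewrite !prim_le0 ?mulr0 ?ltW.
by rewrite /prim RintegralZl//; exact: lf.
Qed.

Lemma primN f t : locint f -> prim (fun s => - f s) t = - prim f t.
Proof.
move=> lf; rewrite -mulN1r -primZ//; congr prim.
by apply/funext => s; rewrite mulN1r.
Qed.

Lemma prim_cst c t : 0 <= t -> prim (fun=> c) t = c * t.
Proof.
move=> t0; rewrite /prim Rintegral_cst//= lebesgue_measure_itv/= lte_fin.
by case: ltgtP t0 => //= [_ _|<-]; rewrite ?subr0// oppr0 addr0.
Qed.

Lemma eq_prim f g t : (forall s, 0 <= s <= t -> f s = g s) -> prim f t = prim g t.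
Proof.
move=> fg; apply: eq_Rintegral => s; rewrite inE/= in_itv/=; exact: fg.
Qed.

Lemma le_primB f g a b : locint f -> locint g -> 0 <= a -> a <= b ->
    (forall s, a < s <= b -> f s <= g s) ->
  prim f b - prim f a <= prim g b - prim g a.
Proof.
move=> lf lg a0 ab fg; rewrite !primB//; apply: le_Rintegral => //;
  exact: locint_itv.
Qed.

Lemma ler_norm_primB f a b : locint f -> 0 <= a -> a <= b ->
  `|prim f b - prim f a| <= prim (fun s => `|f s|) b - prim (fun s => `|f s|) a.
Proof.
move=> lf a0 ab; have ln := locint_norm lf.
rewrite !primB//; apply: le_normr_Rintegral => //.
exact: locint_itv.
Qed.

Lemma ler_primB_cst f c a b : locint f -> 0 <= a -> a <= b ->
    (forall s, a < s <= b -> f s <= c) ->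
  prim f b - prim f a <= c * (b - a).
Proof.
move=> lf a0 ab fc; rewrite mulrBr -!prim_cst//; last exact: le_trans ab.
by apply: le_primB => //; apply: locint_continuous => ?; exact: cvg_cst.
Qed.

End Primitive.

(** * Comparison by right slopes *)

Section Dini.
Context {R : realType}.
Implicit Types (w y : R -> R) (t T a h : R).

(** A bound from above on the upper right Dini derivative. *)
Definition rslope_le w t a := forall e : R, 0 < e ->
  \forall h \near (0 : R)^'+, w (t + h) - w t <= (a + e) * h.

Lemma rslope_leW w t a b : a <= b -> rslope_le w t a -> rslope_le w t b.
Proof.
move=> ab wa e e0; near=> h.
have h0 : 0 < h by near: h; exact: nbhs_right_gt.
have /le_trans -> // : w (t + h) - w t <= (a + e) * h by near: h; exact: wa.
by rewrite ler_pM2r// lerD2r.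
Unshelve. all: by end_near. Qed.

Lemma rslope_leD w y t a b :
  rslope_le w t a -> rslope_le y t b -> rslope_le (fun s => w s + y s) t (a + b).
Proof.
move=> wa yb e e0; have e20 : 0 < e / 2 by rewrite divr_gt0.
near=> h.
have wh : w (t + h) - w t <= (a + e / 2) * h by near: h; exact: wa.
have yh : y (t + h) - y t <= (b + e / 2) * h by near: h; exact: yb.
by lra.
Unshelve. all: by end_near. Qed.

Lemma continuous_at_right0 w t : {for t, continuous w} ->
  w (t + h) @[h --> 0^'+] --> w t.
Proof.
move=> wt; apply: cvg_at_right_filter.
have -> : w t = w (t + 0) by rewrite addr0.
apply: (@continuous_comp _ _ _ (fun h => t + h) w).
  by apply: cvgD; [exact: cvg_cst|exact: cvg_id].
by rewrite addr0.
Qed.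

Lemma derive_rslope w t a : is_derive t 1 w a -> rslope_le w t a.
Proof.
move=> [+ <-] e e0; rewrite /derivable/= => /cvg_dnbhs_at_right.
move=> /cvgr_le /(_ ('D_1 w t + e)).
rewrite ltrDl => /(_ e0) H; near=> h.
have h0 : 0 < h by near: h; exact: nbhs_right_gt.
have : h^-1 *: (w (h *: 1 + t) - w t) <= 'D_1 w t + e by near: h; exact: H.
by rewrite /GRing.scale/= mulr1 ler_pdivrMl// [h + t]addrC mulrC.
Unshelve. all: by end_near. Qed.

(** If w T > 0, a function w - e (t + 1) with small e > 0 is negative at 0 and
    positive at T.  At its last nonpositive point a the function w is positive, so
    that the slope condition keeps w - e (t + 1) from growing just after a.  *)
Lemma dini_le0 w T : 0 <= T ->
    (forall t, 0 <= t <= T -> {for t, continuous w}) -> w 0 <= 0 ->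
    (forall t, 0 <= t < T -> 0 < w t -> rslope_le w t 0) ->
  w T <= 0.
Proof.
move=> T0 cw w0 dw; rewrite leNgt; apply/negP => wT.
(* This e makes phi T = w T / 2, and the shift by 1 makes phi 0 < 0. *)
pose e := w T / (2 * (T + 1)); pose phi t := w t - e * (t + 1).
have T1 : 0 < T + 1 by rewrite ltr_pwDr.
have e0 : 0 < e by rewrite divr_gt0// mulr_gt0.
have phiT : 0 < phi T.
  rewrite /phi; have -> : e * (T + 1) = w T / 2 by rewrite /e; field; lra.
  by lra.
have cphi t : 0 <= t <= T -> {for t, continuous phi}.
  move=> tT; apply: cvgB; first exact: cw.
  by apply: cvgM; [exact: cvg_cst|apply: cvgD; [exact: cvg_id|exact: cvg_cst]].
pose A := [set t | 0 <= t <= T /\ phi t <= 0].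
have A0 : A 0 by split; rewrite ?lexx// /phi; lra.
have supA : has_sup A by split; [exists 0|exists T => t [/andP[]]].
pose a := sup A.
have a0 : 0 <= a by exact: sup_upper_bound.
have aT : a <= T by apply: ge_sup; [exists 0|move=> t [/andP[]]].
have aTb : 0 <= a <= T by rewrite a0.
have pa : phi a <= 0.
  rewrite leNgt; apply/negP => pa.
  have /cvgr_gt /(_ _ pa) /nbhs_ballP[r /= r0 br] := cphi a aTb.
  have [t [tT pt] at_] := sup_adherent r0 supA.
  have ta : t <= a by apply: sup_upper_bound.
  have /br : ball a r t by rewrite /ball/= ger0_norm ?subr_ge0// ltrBlDr addrC -ltrBlDr.
  by rewrite ltNge pt.
have {}aT : a < T.
  by rewrite lt_neqAle aT andbT; apply/eqP => aT'; rewrite aT' leNgt phiT in pa.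
have aA h : 0 < h -> a + h <= T -> 0 < phi (a + h).
  move=> h0 ahT; rewrite ltNge; apply/negP => pah.
  have : a + h <= a.
    by apply: sup_upper_bound => //; split=> //; rewrite ahT addr_ge0// ltW.
  by apply/negP; rewrite -ltNge ltrDl.
have pa' : 0 <= phi a.
  rewrite leNgt; apply/negP => pa'.
  have /cvgr_lt /(_ _ pa') pn := continuous_at_right0 (cphi a aTb).
  near (0 : R)^'+ => h.
  have h0 : 0 < h by near: h; exact: nbhs_right_gt.
  have ahT : a + h <= T.
    by rewrite -lerBrDl; near: h; apply: nbhs_right_le; rewrite subr_gt0.
  have := aA h h0 ahT; rewrite ltNge => /negP; apply; apply: ltW.
  by near: h; exact: pn.
have wa : 0 < w a.
  have : w a = phi a + e * (a + 1) by rewrite /phi; lra.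
  by move=> ->; rewrite ltr_wpDl// mulr_gt0// ltr_pwDr.
have e20 : 0 < e / 2 by rewrite divr_gt0.
have aTr : 0 <= a < T by rewrite a0.
have dwa := dw a aTr wa (e / 2) e20.
near (0 : R)^'+ => h.
have h0 : 0 < h by near: h; exact: nbhs_right_gt.
have ahT : a + h <= T.
  by rewrite -lerBrDl; near: h; apply: nbhs_right_le; rewrite subr_gt0.
have := aA h h0 ahT; rewrite ltNge => /negP; apply.
have : w (a + h) - w a <= (0 + e / 2) * h.
  by near: h; exact: dwa.
rewrite /phi in pa *; have : 0 < e * h by rewrite mulr_gt0.
by lra.
Unshelve. all: by end_near. Qed.

End Dini.

(** * First-order expansions along an input *)

Section Expansion.
Context {R : realType}.
Variables (A : R -> R) (N : R).
Hypothesis AN : \forall h \near (0 : R)^'+, `|A h| <= N * h.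
Implicit Types (a b e h : R).

(** F h = F0 + a h + b A(h) + o(h) as h decreases to 0.  The function A is an
    increment of the integrated input, of order h but without any derivative,
    so that (a, b) acts as a gradient in two infinitesimals h and A(h). *)
Definition expands (F : R -> R) (F0 : R) a b := forall e, 0 < e ->
  \forall h \near (0 : R)^'+, `|F h - F0 - (a * h + b * A h)| <= e * h.

Lemma expands_cst c : expands (fun=> c) c 0 0.
Proof.
move=> e e0; near=> h.
have h0 : 0 < h by near: h; exact: nbhs_right_gt.
by rewrite subrr !mul0r addr0 subrr normr0 mulr_ge0// ltW.
Unshelve. all: by end_near. Qed.

Lemma expandsD (F G : R -> R) (F0 G0 : R) a b c d : expands F F0 a b -> expands G G0 c d ->
  expands (fun h => F h + G h) (F0 + G0) (a + c) (b + d).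
Proof.
move=> Fa Gc e e0; have e20 : 0 < e / 2 by rewrite divr_gt0.
near=> h.
have Fh : `|F h - F0 - (a * h + b * A h)| <= (e / 2) * h by near: h; exact: Fa.
have Gh : `|G h - G0 - (c * h + d * A h)| <= (e / 2) * h by near: h; exact: Gc.
have -> : F h + G h - (F0 + G0) - ((a + c) * h + (b + d) * A h) =
  (F h - F0 - (a * h + b * A h)) + (G h - G0 - (c * h + d * A h)) by ring.
by rewrite (le_trans (ler_normD _ _))//; lra.
Unshelve. all: by end_near. Qed.

Lemma expands_lipschitz (F : R -> R) (F0 : R) a b : expands F F0 a b ->
  exists2 K : R, 0 < K & \forall h \near (0 : R)^'+, `|F h - F0| <= K * h.
Proof.
move=> Fa; exists (`|a| + `|b| * `|N| + 1); first by rewrite ltr_wpDl// addr_ge0// mulr_ge0.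
near=> h.
have h0 : 0 < h by near: h; exact: nbhs_right_gt.
have Fh : `|F h - F0 - (a * h + b * A h)| <= 1 * h by near: h; exact: Fa.
have Ah : `|A h| <= N * h by near: h; exact: AN.
rewrite -[F h - F0](subrK (a * h + b * A h)) (le_trans (ler_normD _ _))//.
rewrite mulrDl addrC lerD// (le_trans (ler_normD _ _))// !normrM (ger0_norm (ltW h0)).
rewrite mulrDl lerD2l -mulrA ler_wpM2l// (le_trans Ah)//.
by apply: ler_wpM2r; [exact: ltW|exact: ler_norm].
Unshelve. all: by end_near. Qed.

(** Leibniz rule: the remainder is that of each factor times the other value,
    plus a product of two increments, which is of order h^2. *)
Lemma expandsM (F G : R -> R) (F0 G0 : R) a b c d : expands F F0 a b -> expands G G0 c d ->
  expands (fun h => F h * G h) (F0 * G0) (a * G0 + F0 * c) (b * G0 + F0 * d).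
Proof.
move=> Fa Gc e e0.
have [K K0 FK] := expands_lipschitz Fa.
have [L L0 GL] := expands_lipschitz Gc.
pose M : R := `|F0| + `|G0| + 1.
have M0 : 0 < M by rewrite ltr_wpDl// addr_ge0.
have [FM GM] : `|F0| <= M /\ `|G0| <= M.
  by rewrite /M; have := normr_ge0 F0; have := normr_ge0 G0; split; lra.
clearbody M.
have e30 : 0 < e / (3 * M) by rewrite divr_gt0// mulr_gt0.
near=> h.
have h0 : 0 < h by near: h; exact: nbhs_right_gt.
have Fh : `|F h - F0 - (a * h + b * A h)| <= e / (3 * M) * h by near: h; exact: Fa.
have Gh : `|G h - G0 - (c * h + d * A h)| <= e / (3 * M) * h by near: h; exact: Gc.
have Fh' : `|F h - F0| <= K * h by near: h; exact: FK.
have Gh' : `|G h - G0| <= L * h by near: h; exact: GL.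
have hs : h <= e / (3 * (K * L)).
  by near: h; apply: nbhs_right_le; rewrite divr_gt0// !mulr_gt0.
have -> : F h * G h - F0 * G0 - ((a * G0 + F0 * c) * h + (b * G0 + F0 * d) * A h)
  = (F h - F0 - (a * h + b * A h)) * G0 + F0 * (G h - G0 - (c * h + d * A h))
    + (F h - F0) * (G h - G0) by ring.
have le1 : `|(F h - F0 - (a * h + b * A h)) * G0| <= e / 3 * h.
  rewrite normrM; apply: (@le_trans _ _ (e / (3 * M) * h * M)); first by rewrite ler_pM.
  by rewrite le_eqVlt; apply/orP; left; apply/eqP; field; rewrite gt_eqF.
have le2 : `|F0 * (G h - G0 - (c * h + d * A h))| <= e / 3 * h.
  rewrite normrM; apply: (@le_trans _ _ (M * (e / (3 * M) * h))); first by rewrite ler_pM.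
  by rewrite le_eqVlt; apply/orP; left; apply/eqP; field; rewrite gt_eqF.
have le3 : `|(F h - F0) * (G h - G0)| <= e / 3 * h.
  rewrite normrM; apply: (@le_trans _ _ ((K * h) * (L * h))); first by rewrite ler_pM.
  have -> : K * h * (L * h) = K * L * h * h by ring.
  rewrite ler_pM2r//.
  have KL : 0 < K * L by rewrite mulr_gt0.
  have /le_trans -> // : K * L * h <= K * L * (e / (3 * (K * L))) by rewrite ler_pM2l.
  by rewrite le_eqVlt; apply/orP; left; apply/eqP; field; rewrite !gt_eqF.
rewrite (le_trans (ler_normD _ _))// (le_trans (lerD (ler_normD _ _) (lexx _)))//.
by lra.
Unshelve. all: by end_near. Qed.

(** Differentiability in the form of a first-order remainder, in which y = x
    needs no exception. *)
Lemma is_derive_little (phi : R -> R) (x l : R) : is_derive x 1 phi l ->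
  forall e, 0 < e -> exists2 r : R, 0 < r &
    forall y, `|y - x| < r -> `|phi y - phi x - l * (y - x)| <= e * `|y - x|.
Proof.
move=> [dphi <-] e e0; move: dphi; rewrite /derivable => /cvgrPdist_le /(_ e e0).
move=> /nbhs_ballP[r /= r0 br]; exists r => // y yxr.
have [->|yx] := eqVneq y x; first by rewrite !subrr mulr0 subrr normr0 mulr0.
have yx0 : y - x != 0 by rewrite subr_eq0.
have := br (y - x); rewrite /ball/= sub0r normrN => /(_ yxr yx0).
rewrite /GRing.scale/= mulr1 subrK -/(derive phi x 1) => H.
have -> : phi y - phi x - 'D_1 phi x * (y - x) =
   - (('D_1 phi x - (y - x)^-1 * (phi y - phi x)) * (y - x)) by field.
by rewrite normrN normrM ler_wpM2r.
Qed.

Lemma expands_comp (phi : R -> R) (l : R) (F : R -> R) (F0 : R) a b : is_derive F0 1 phi l -> expands F F0 a b ->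
  expands (fun h => phi (F h)) (phi F0) (l * a) (l * b).
Proof.
move=> dphi Fa e e0; have [K K0 FK] := expands_lipschitz Fa.
have e1 : 0 < e / (2 * K) by rewrite divr_gt0// mulr_gt0.
have [r r0 phir] := is_derive_little dphi e1.
have e2 : 0 < e / (2 * (`|l| + 1)) by rewrite divr_gt0// mulr_gt0// ltr_wpDl.
near=> h.
have h0 : 0 < h by near: h; exact: nbhs_right_gt.
have Fh : `|F h - F0 - (a * h + b * A h)| <= e / (2 * (`|l| + 1)) * h.
  by near: h; exact: Fa.
have Fh' : `|F h - F0| <= K * h by near: h; exact: FK.
have /phir Fr : `|F h - F0| < r.
  rewrite (le_lt_trans Fh')// -ltr_pdivlMl// mulrC.
  by near: h; apply: nbhs_right_lt; rewrite divr_gt0.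
have -> : phi (F h) - phi F0 - (l * a * h + l * b * A h) =
   (phi (F h) - phi F0 - l * (F h - F0)) + l * (F h - F0 - (a * h + b * A h)) by ring.
rewrite (le_trans (ler_normD _ _))// normrM.
have le1 : e / (2 * K) * `|F h - F0| <= e / 2 * h.
  apply: (@le_trans _ _ (e / (2 * K) * (K * h))); first by rewrite ler_pM2l.
  by rewrite le_eqVlt; apply/orP; left; apply/eqP; field; rewrite gt_eqF.
have le2 : `|l| * `|F h - F0 - (a * h + b * A h)| <= e / 2 * h.
  have l1 : 0 < `|l| + 1 by rewrite ltr_wpDl.
  apply: (@le_trans _ _ ((`|l| + 1) * (e / (2 * (`|l| + 1)) * h))).
    by rewrite ler_pM// lerDl.
  by rewrite le_eqVlt; apply/orP; left; apply/eqP; field; rewrite gt_eqF.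
by lra.
Unshelve. all: by end_near. Qed.

Lemma expands_le (F : R -> R) (F0 : R) a b e : 0 < e -> expands F F0 a b ->
  \forall h \near (0 : R)^'+, F h - F0 <= (a + e) * h + `|b| * `|A h|.
Proof.
move=> e0 Fa; near=> h.
have Fh : `|F h - F0 - (a * h + b * A h)| <= e * h by near: h; exact: Fa.
have := ler_norm (b * A h); rewrite normrM => bA.
have := le_trans (ler_norm _) Fh; lra.
Unshelve. all: by end_near. Qed.

End Expansion.

(** The integral of a continuous function has a true right derivative and no
    component along A. *)
Lemma expands_prim {R : realType} (A f : R -> R) t : continuous f -> 0 <= t ->
  expands A (fun h => prim f (t + h)) (prim f t) (f t) 0.
Proof.
move=> cf t0 e e0; have /cvgrPdist_le /(_ e e0) fe := continuous_at_right0 (cf t).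
have [r r0 fr] : exists2 r : R, 0 < r & forall s, 0 < s < r -> `|f t - f (t + s)| <= e.
  move: fe => /nbhs_ballP [r /= r0 br]; exists r => // s /andP[s0 sr].
  by apply: br => //; rewrite /ball/= sub0r normrN gtr0_norm.
have lf := locint_continuous cf.
have lfN : locint (fun s => - f s) by apply: locint_continuous => s; apply: cvgN; exact: cf.
near=> h.
have h0 : 0 < h by near: h; exact: nbhs_right_gt.
have hr : h < r by near: h; exact: nbhs_right_lt.
have th : t <= t + h by rewrite lerDl ltW.
have fs s : t < s <= t + h -> `|f t - f s| <= e.
  move=> /andP[ts sth]; have := fr (s - t); rewrite [t + _]addrC subrK; apply.
  by rewrite subr_gt0 ts/= (le_lt_trans _ hr)// lerBlDl.
have U : prim f (t + h) - prim f t <= (f t + e) * (t + h - t).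
  by apply: ler_primB_cst => // s /fs; rewrite ler_norml => /andP[? ?]; lra.
have D : prim (fun s => - f s) (t + h) - prim (fun s => - f s) t
     <= (e - f t) * (t + h - t).
  by apply: ler_primB_cst => // s /fs; rewrite ler_norml => /andP[? ?]; lra.
rewrite !primN// in D.
rewrite mul0r addr0 ler_norml; apply/andP; split; lra.
Unshelve. all: by end_near. Qed.

(** * The Lyapunov function of the scaled system *)

Section Lyapunov.
Context {R : realType}.
Implicit Types x y z v : R.

(** The denominator of the scaled system. *)
Definition msat x : R := Num.max 1 `|x|.

(** Twice the potential of the scaled restoring force x / max (1, |x|): quadratic
    near the origin, affine in |x| far from it. *)
Definition qpot x : R := if `|x| <= 1 then x ^+ 2 else 2 * `|x| - 1.

Lemma msat_ge1 x : 1 <= msat x.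
Proof. by rewrite /msat le_max lexx. Qed.

Lemma msat_gt0 x : 0 < msat x.
Proof. exact: lt_le_trans (msat_ge1 x). Qed.

Lemma msatE x : msat x = if `|x| <= 1 then 1 else `|x|.
Proof. by rewrite /msat; case: (leP `|x| 1). Qed.

(** The derivative 2 x / msat x is 2-Lipschitz, whence a second-order Taylor
    remainder with constant 1 that also covers the junctions |x| = 1. *)
Lemma qpot_quadratic x y :
  `|qpot y - qpot x - 2 * x / msat x * (y - x)| <= (y - x) ^+ 2.
Proof.
have -> : 2 * x / msat x = if `|x| <= 1 then 2 * x else 2 * Num.sg x.
  rewrite msatE; case: ifP => x1; first by rewrite divr1.
  have xn0 : x != 0.
    by apply/eqP => x0; rewrite x0 normr0 ler01 in x1.
  by rewrite {1}[x]numEsg -!mulrA mulfV ?mulr1// normr_eq0.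
rewrite ler_norml /qpot; case: ifPn => hy; case: ifPn => hx;
  rewrite -?ltNge in hx hy; move: hx hy;
  case: (sgrP x) => [->|x0|x0]; case: (sgrP y) => [->|y0|y0]; rewrite ?normr0 => hx hy;
  have sq := sqr_ge0 (y - x); apply/andP; split; solve [lra | nra].
Qed.

Lemma is_derive_quadratic (f : R -> R) x l :
    (forall y, `|f y - f x - l * (y - x)| <= (y - x) ^+ 2) ->
  is_derive x 1 f l.
Proof.
move=> fq; suff H : h^-1 *: (f (h *: 1 + x) - f x) @[h --> 0^'] --> l.
  by apply: DeriveDef; [apply/cvg_ex; exists l|apply/cvg_lim].
apply/cvgrPdist_le => e e0; near=> h.
have h0 : h != 0 by near: h; exact: nbhs_dnbhs_neq.
have := fq (h + x); rewrite addrK /GRing.scale/= mulr1 => H.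
have -> : l - h^-1 * (f (h + x) - f x) = - (h^-1 * (f (h + x) - f x - l * h)) by field.
rewrite normrN normrM normfV ler_pdivrMl ?normr_gt0// (le_trans H)//.
rewrite -real_normK ?num_real// expr2 ler_wpM2l//.
by near: h; apply: dnbhs0_le.
Unshelve. all: by end_near. Qed.

Lemma is_derive_qpot x : is_derive x 1 qpot (2 * x / msat x).
Proof. exact/is_derive_quadratic/qpot_quadratic. Qed.

Lemma qpot_ge0 x : 0 <= qpot x.
Proof. by rewrite /qpot; case: (leP `|x| 1) => h; [exact: sqr_ge0|lra]. Qed.

Lemma qpot_le_sqr x : qpot x <= x ^+ 2.
Proof.
rewrite /qpot; case: (leP `|x| 1) => h //; rewrite -(real_normK (num_real x)).
by have := sqr_ge0 (`|x| - 1); lra.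
Qed.

(** The exact growth of qpot at infinity; it makes the cross term X1 X2 / (1 + V)
    at most half of sqrt V, hence a perturbation of sqrt V. *)
Lemma norm_le_qpot x : `|x| <= (1 + qpot x) / 2.
Proof.
rewrite /qpot; case: (leP `|x| 1) => h; last lra.
rewrite -(real_normK (num_real x)).
by have := sqr_ge0 (`|x| - 1); lra.
Qed.

Lemma msat_le_qpot x : msat x <= 1 + qpot x.
Proof.
by rewrite msatE /qpot; case: (leP `|x| 1) => h; [rewrite lerDl sqr_ge0|lra].
Qed.

Lemma qpot_le_sqr_msat x : qpot x / 2 <= x ^+ 2 / msat x.
Proof.
rewrite msatE /qpot; case: (leP `|x| 1) => h; first by rewrite divr1; have := sqr_ge0 x; lra.
have x0 : 0 < `|x| by lra.
by rewrite -(real_normK (num_real x)) expr2 mulfK ?gt_eqF//; lra.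
Qed.

Lemma norm_le_msat x : `|x| <= msat x.
Proof. by rewrite /msat le_max lexx orbT. Qed.

Definition energy (x1 x2 : R) : R := x2 ^+ 2 + qpot x1.

(** The cross term is bounded by sqrt V / 2; its weight 1/20 is small enough for
    the damping to absorb the positive contribution x2^2 of its derivative. *)
Definition lyap (x1 x2 : R) : R :=
  Num.sqrt (energy x1 x2) + 20^-1 * ((x1 * x2) * (1 + energy x1 x2)^-1).

(** Decay rate of the Lyapunov function: quadratic at 0, where the damping is
    weak, and bounded at infinity. *)
Definition prate z : R := z ^+ 2 / (1 + z ^+ 2).

Lemma energy_ge0 x1 x2 : 0 <= energy x1 x2.
Proof. by rewrite addr_ge0 ?sqr_ge0 ?qpot_ge0. Qed.

Lemma cross_le x1 x2 :
  `|(x1 * x2) * (1 + energy x1 x2)^-1| <= Num.sqrt (energy x1 x2) / 2.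
Proof.
have V0 := energy_ge0 x1 x2; set V := energy x1 x2 in V0 *.
have V1 : 0 < 1 + V by lra.
rewrite normrM normfV (gtr0_norm V1) ler_pdivrMr// normrM.
have x1V : `|x1| <= (1 + V) / 2.
  rewrite (le_trans (norm_le_qpot x1))// ler_pM2r// lerD2l /V /energy lerDr sqr_ge0//.
have x2V : `|x2| <= Num.sqrt V.
  by rewrite -sqrtr_sqr ler_sqrt// /V /energy lerDl qpot_ge0.
have := ler_pM (normr_ge0 _) (normr_ge0 _) x1V x2V; lra.
Qed.

Lemma lyap_bounds x1 x2 :
  Num.sqrt (energy x1 x2) * (39 / 40) <= lyap x1 x2 <=
  Num.sqrt (energy x1 x2) * (41 / 40).
Proof.
have := cross_le x1 x2; rewrite ler_norml /lyap => /andP[? ?].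
by apply/andP; split; lra.
Qed.

Lemma ler_frac (a b : R) : 0 <= a -> a <= b -> a / (1 + a) <= b / (1 + b).
Proof.
move=> a0 ab; have b0 := le_trans a0 ab.
have a1 : 0 < 1 + a by lra.
have b1 : 0 < 1 + b by lra.
by rewrite ler_pdivrMr// mulrAC ler_pdivlMr//; lra.
Qed.

Lemma prate_homo y z : 0 <= y -> y <= z -> prate y <= prate z.
Proof.
move=> y0 yz; apply: ler_frac; first exact: sqr_ge0.
by rewrite ler_pXn2r ?nnegrE//; lra.
Qed.

Lemma prate_lyap x1 x2 (V := energy x1 x2) :
  prate (lyap x1 x2) <= 2 * (V / (1 + V)).
Proof.
have V0 : 0 <= V by exact: energy_ge0.
have /andP[l1 l2] := lyap_bounds x1 x2; rewrite -/V in l1 l2.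
have v0 := sqrtr_ge0 V; have vV : Num.sqrt V ^+ 2 = V by rewrite sqr_sqrtr.
set z := lyap x1 x2 in l1 l2 *; set v := Num.sqrt V in l1 l2 v0 vV.
have zV : z ^+ 2 <= 2 * V by rewrite -vV; nra.
apply: (le_trans (ler_frac (sqr_ge0 z) zV)).
have V1 : 0 < 1 + V by lra.
have V2 : 0 < 1 + 2 * V by lra.
rewrite ler_pdivrMr// !mulrA mulrAC ler_pdivlMr//; nra.
Qed.

(** The left-hand side is the derivative of lyap along the unforced scaled
    system, in the form in which the chain rule produces it; dV is the derivative
    of the energy, equal to - 2 S with S = |x2|^3 / msat x1.  The cross term
    contributes - x1^2 / msat x1 <= - (V - x2^2) / 2, which is negative where the
    damping is not, and terms of order x2^2.  Up to the factor 1 / (1 + V) and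
    with v = sqrt V, there remains
    - |x2|^3 / v + (9/2 x2^2 - v^2 / 2) / 20 <= - v^2 / 80. *)
Lemma lyap_drift x1 x2 (V := energy x1 x2)
    (g := - ((x1 + `|x2| * x2) / msat x1))
    (dV := 2 * x1 / msat x1 * x2 + 2 * x2 * g) : 0 < V ->
  (2 * Num.sqrt V)^-1 * dV + 20^-1 * ((x2 * x2 + x1 * g) * (1 + V)^-1
     + (x1 * x2) * (- (1 + V) ^- 2 * dV))
  <= - (160^-1 * prate (lyap x1 x2)).
Proof.
move=> V0.
have pl : prate (lyap x1 x2) <= 2 * (V / (1 + V)) by exact: prate_lyap.
apply: (@le_trans _ _ (- (80^-1 * (V / (1 + V))))); last lra.
have V1 : 0 < 1 + V by lra.
pose S := `|x2| ^+ 3 / msat x1.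
have m0 := msat_gt0 x1; have m1 := msat_ge1 x1.
have x22 : x2 ^+ 2 = `|x2| ^+ 2 by rewrite real_normK ?num_real.
have dVE : dV = - 2 * S.
  by rewrite /dV /g /S exprS -x22; field; rewrite gt_eqF.
have V1m : msat x1 <= 1 + V.
  by rewrite (le_trans (msat_le_qpot x1))// lerD2l /V /energy lerDr sqr_ge0.
have s0 := normr_ge0 x2.
have S0 : 0 <= S by rewrite divr_ge0 ?exprn_ge0// ltW.
have Slow : `|x2| ^+ 3 / (1 + V) <= S.
  by rewrite ler_wpM2l ?exprn_ge0// lef_pV2 ?posrE.
have SE : S = `|x2| ^+ 3 / msat x1 by [].
clearbody S.
have v0 : 0 < Num.sqrt V by rewrite sqrtr_gt0.
have vV : Num.sqrt V ^+ 2 = V by rewrite sqr_sqrtr ?ltW.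
have t1 : x1 * g <= - (V - x2 ^+ 2) / 2 + x2 ^+ 2.
  have := qpot_le_sqr_msat x1.
  have : - (x1 * (`|x2| * x2)) / msat x1 <= x2 ^+ 2.
    rewrite ler_pdivrMr// (le_trans (ler_norm _))// normrN !normrM normr_id.
    have -> : `|x1| * (`|x2| * `|x2|) = `|x2| ^+ 2 * `|x1| by ring.
    by rewrite -x22 ler_wpM2l ?sqr_ge0// norm_le_msat.
  have -> : x1 * g = - (x1 ^+ 2 / msat x1) + - (x1 * (`|x2| * x2)) / msat x1.
    by rewrite /g; field; rewrite gt_eqF.
  by rewrite /V /energy; lra.
have t2 : (x1 * x2) * (2 * S) <= 2 * x2 ^+ 2 * (1 + V).
  have x1m : `|x1| / msat x1 <= 1 by rewrite ler_pdivrMr// mul1r norm_le_msat.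
  apply: (@le_trans _ _ (2 * (`|x1| / msat x1) * `|x2| ^+ 4)).
    rewrite (le_trans (ler_norm _))// !normrM (ger0_norm S0) normr_nat SE.
    by rewrite le_eqVlt; apply/orP; left; apply/eqP; field; rewrite gt_eqF.
  have x2V : `|x2| ^+ 2 <= V by rewrite -x22 /V /energy lerDl qpot_ge0.
  have x1m0 : 0 <= `|x1| / msat x1 by rewrite divr_ge0// ltW.
  rewrite x22; set s := `|x2| in s0 x2V *; set r := _ / _ in x1m x1m0 *.
  have -> : s ^+ 4 = s ^+ 2 * s ^+ 2 by ring.
  have := sqr_ge0 s; set s2 := s ^+ 2 in x2V *; nra.
rewrite dVE.
have -> : (2 * Num.sqrt V)^-1 * (- 2 * S) + 20^-1 * ((x2 * x2 + x1 * g) * (1 + V)^-1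
     + (x1 * x2) * (- (1 + V) ^- 2 * (- 2 * S))) =
   - (S / Num.sqrt V) + 20^-1 * ((x2 ^+ 2 + x1 * g) + x1 * x2 * (2 * S) / (1 + V)) / (1 + V).
  by field; rewrite !gt_eqF.
have t2' : x1 * x2 * (2 * S) / (1 + V) <= 2 * x2 ^+ 2 by rewrite ler_pdivrMr.
have t3 : - (S / Num.sqrt V) <= - (`|x2| ^+ 3 / Num.sqrt V) / (1 + V).
  by rewrite mulNr lerN2 mulrAC ler_pM2r ?invr_gt0.
have t4 : 20^-1 * ((x2 ^+ 2 + x1 * g) + x1 * x2 * (2 * S) / (1 + V)) / (1 + V)
   <= 20^-1 * (9 / 2 * x2 ^+ 2 - V / 2) / (1 + V).
  by rewrite ler_pM2r ?invr_gt0//; lra.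
apply: (le_trans (lerD t3 t4)).
rewrite -mulrDl [80^-1 * _]mulrA -[X in _ <= X]mulNr.
rewrite ler_pM2r ?invr_gt0//.
move: v0 vV; rewrite x22; move: (Num.sqrt V) (`|x2|) s0 => v s s0 v0 <-.
have -> : - (s ^+ 3 / v) + 20^-1 * (9 / 2 * s ^+ 2 - v ^+ 2 / 2) =
  (- s ^+ 3 + 20^-1 * (9 / 2 * s ^+ 2 - v ^+ 2 / 2) * v) / v by field; rewrite gt_eqF.
rewrite ler_pdivrMr//.
(* This product is s^3 - 9/40 s^2 v + 27/16000 v^3, without a term in s v^2. *)
have : 0 <= (s - 3 / 20 * v) ^+ 2 * (s + 3 / 40 * v).
  by rewrite mulr_ge0 ?sqr_ge0//; lra.
have : 0 <= v ^+ 3 by rewrite exprn_ge0// ltW.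
rewrite !expr2 !exprS expr0; lra.
Qed.

(** The derivative of lyap in x2, the direction in which the input enters. *)
Lemma lyap_gain x1 x2 (V := energy x1 x2) : 0 < V ->
  `|(2 * Num.sqrt V)^-1 * (2 * x2) + 20^-1 * (x1 * (1 + V)^-1
     + (x1 * x2) * (- (1 + V) ^- 2 * (2 * x2)))| <= 2.
Proof.
move=> V0.
have V1 : 0 < 1 + V by lra.
have v0 : 0 < Num.sqrt V by rewrite sqrtr_gt0.
have x1V : `|x1| / (1 + V) <= 1 / 2.
  rewrite ler_pdivrMr//; have := norm_le_qpot x1.
  by have := sqr_ge0 x2; rewrite /V /energy; lra.
have x2V : `|x2| / Num.sqrt V <= 1.
  rewrite ler_pdivrMr// mul1r.
  by have V0' := ltW V0; rewrite -sqrtr_sqr ler_sqrt// /V /energy lerDl qpot_ge0.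
have x22V : x2 ^+ 2 / (1 + V) <= 1.
  by rewrite ler_pdivrMr// mul1r /V /energy; have := qpot_ge0 x1; lra.
have x220 : 0 <= x2 ^+ 2 / (1 + V) by rewrite divr_ge0 ?sqr_ge0// ltW.
have -> : (2 * Num.sqrt V)^-1 * (2 * x2) + 20^-1 * (x1 * (1 + V)^-1
     + (x1 * x2) * (- (1 + V) ^- 2 * (2 * x2))) =
   x2 / Num.sqrt V + 20^-1 * (x1 / (1 + V) - 2 * (x1 / (1 + V) * (x2 ^+ 2 / (1 + V)))).
  by field; rewrite !gt_eqF.
have n1 : `|x2 / Num.sqrt V| <= 1 by rewrite normrM normfV (gtr0_norm v0).
have n2 : `|x1 / (1 + V)| <= 1 / 2 by rewrite normrM normfV (gtr0_norm V1).
have n3 : `|x1 / (1 + V) * (x2 ^+ 2 / (1 + V))| <= 1 / 2.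
  by rewrite normrM (ger0_norm x220) -[leRHS]mulr1 ler_pM.
move: n1 n2 n3; rewrite !ler_norml => /andP[? ?] /andP[? ?] /andP[? ?].
by apply/andP; split; lra.
Qed.

End Lyapunov.

(** * Volterra equations *)

Section Picard.
Context {R : realType}.
Implicit Types (y z : R -> R) (T s t e : R).

Lemma rslope_prim (f : R -> R) t : continuous f -> 0 <= t ->
  rslope_le (prim f) t (f t).
Proof.
move=> cf t0 e e0.
have := @expands_prim R (fun=> 0) f t cf t0 e e0.
apply: filterS => h; rewrite mulr0 addr0 => /(le_trans (ler_norm _)); lra.
Qed.

(** One half of the fundamental theorem of calculus, as a comparison by right
    slopes. *)
Lemma prim_le_antiderivative (f F : R -> R) T : continuous f -> 0 <= T ->
    (forall t, is_derive t 1 F (f t)) -> prim f T <= F T - F 0.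
Proof.
move=> cf T0 dF.
have cF t : {for t, continuous F}.
  by apply/differentiable_continuous/derivable1_diffP; exact: (@ex_derive _ _ _ _ _ _ _ (dF t)).
suff : prim f T + - F T + F 0 <= 0 by lra.
apply: (@dini_le0 R (fun t => prim f t + - F t + F 0)) => // [t _||t /andP[t0 _] _].
- apply: cvgD; last exact: cvg_cst.
  by apply: cvgB; [exact/prim_continuous/locint_continuous|exact: cF].
- by rewrite prim_le0// add0r addNr.
- have dNF := derive_rslope (is_deriveN (dF t)).
  have dc : rslope_le (fun=> F 0) t 0.
    by move=> e e0; near=> h; rewrite subrr add0r mulr_ge0// ltW//; near: h; exact: nbhs_right_gt.
  have := rslope_leD (rslope_leD (rslope_prim cf t0) dNF) dc.
  by rewrite subrr addr0.
Unshelve. all: by end_near. Qed.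

Lemma exists_expn2_lt (C e : R) : 0 < e -> exists n, C / 2 ^+ n < e.
Proof.
move=> e0; have h2 : `|2^-1 : R| < 1.
  by rewrite ger0_norm ?invr_ge0// invf_lt1// ltr1n.
have /cvgr_lt /(_ e e0) [N _ HN] := @cvg_geometric R C 2^-1 h2.
by exists N; have := HN N (leqnn N); rewrite /geometric/= exprVn.
Qed.

Lemma le0_expn2 (C a : R) : (forall n, a <= C / 2 ^+ n) -> a <= 0.
Proof.
move=> aC; rewrite leNgt; apply/negP => a0.
have [n] := exists_expn2_lt C a0.
by apply/negP; rewrite -leNgt.
Qed.

(** N is a causal operator on functions: its value at s depends, in a Lipschitz
    way, only on the restriction of the argument to [0, s]. *)
Variables (N : (R -> R) -> R -> R) (b : R -> R).
Hypothesis cb : continuous b.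
Hypothesis Ncont : forall y, continuous y -> continuous (N y).
Hypothesis Nlip : forall T, exists2 L : R, 0 <= L &
  forall y z, continuous y -> continuous z -> forall s M, 0 <= s <= T ->
    (forall r, 0 <= r <= s -> `|y r - z r| <= M) -> `|N y s - N z s| <= L * M.

Definition volterra y t := b t + prim (N y) t.

Lemma volterra_continuous y : continuous y -> continuous (volterra y).
Proof.
move=> cy t; apply: cvgD; first exact: cb.
exact/prim_continuous/locint_continuous/Ncont.
Qed.

Lemma volterraB y z t : continuous y -> continuous z -> 0 <= t ->
  `|volterra y t - volterra z t| <= prim (fun s => `|N y s - N z s|) t.
Proof.
move=> cy cz t0; rewrite /volterra opprD addrACA subrr add0r.
have ly := locint_continuous (Ncont cy).
have lz : locint (fun s => - N z s).
  by apply: locint_continuous => s; apply: cvgN; exact: Ncont.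
rewrite -primN; last exact/locint_continuous/Ncont.
rewrite -primD//; have := ler_norm_primB (locintD ly lz) (lexx 0) t0.
by rewrite ![prim _ 0]prim_le0// !subr0.
Qed.

(** In the norm weighted by exp (- lambda t) integration has norm at most
    1 / lambda, so that lambda > 2 L yields the contraction factor 1/2 on the
    whole interval. *)
Lemma volterra_contracting T : 0 <= T -> exists2 lambda : R, 0 <= lambda &
  forall y z, continuous y -> continuous z -> forall K, 0 <= K ->
    (forall r, 0 <= r <= T -> `|y r - z r| <= K * expR (lambda * r)) ->
    forall t, 0 <= t <= T ->
      `|volterra y t - volterra z t| <= K / 2 * expR (lambda * t).
Proof.
move=> T0; have [L L0 NL] := Nlip T.
(* The summand 1 keeps l positive when L = 0. *)
pose l : R := 2 * L + 1; have l0 : 0 < l by rewrite /l; lra.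
exists l; first exact: ltW.
move=> y z cy cz K K0 yz t /andP[t0 tT]; apply: (le_trans (volterraB cy cz t0)).
pose f s := (K / 2 * l) * expR (l * s).
have cf : continuous f.
  move=> s; apply: cvgM; first exact: cvg_cst.
  apply: (@continuous_comp _ _ _ (fun s => l * s) expR); last exact: continuous_expR.
  by apply: cvgM; [exact: cvg_cst|exact: cvg_id].
have cyz : continuous (fun s => `|N y s - N z s|).
  by move=> s; apply: cvg_norm; apply: cvgB; exact: Ncont.
have : prim (fun s => `|N y s - N z s|) t - prim (fun s => `|N y s - N z s|) 0
    <= prim f t - prim f 0.
  apply: le_primB => //; try exact: locint_continuous.
  move=> s /andP[s0 st]; rewrite /f.
  have sT : 0 <= s <= T by rewrite (ltW s0) (le_trans st).
  have : `|N y s - N z s| <= L * (K * expR (l * s)).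
    apply: NL => // r /andP[r0 rs]; apply: (le_trans (yz r _)).
      by rewrite r0 (le_trans rs)//; case/andP: sT.
    by rewrite ler_wpM2l// ler_expR ler_pM2l.
  move=> /le_trans; apply; rewrite mulrA ler_pM2r ?expR_gt0//.
  by rewrite /l; nra.
rewrite ![prim _ 0]prim_le0// !subr0 => /le_trans; apply.
have dF s : is_derive s 1 (fun s => K / 2 * expR (l * s)) (f s).
  have dl : is_derive s 1 (fun s : R => l * s) l.
    by apply: is_derive_eq; rewrite /GRing.scale/= mulr1.
  have de : is_derive s 1 (fun s => expR (l * s)) (expR (l * s) * l).
    exact: (@is_derive1_comp R expR (fun s => l * s)).
  rewrite /f; apply: is_derive_eq; rewrite /GRing.scale/=; ring.
apply: (le_trans (prim_le_antiderivative cf t0 dF)).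
by rewrite lerBlDr lerDl mulr_ge0 ?expR_ge0// divr_ge0.
Qed.

Definition picard n := iter n volterra b.

Lemma picard_continuous n : continuous (picard n).
Proof. by elim: n => [|n IH]; [exact: cb|exact: volterra_continuous]. Qed.

Lemma picard_neg n t : t <= 0 -> picard n t = b t.
Proof. by case: n => // n t0; rewrite /= /volterra prim_le0// addr0. Qed.

Lemma picardS_bound T : 0 <= T -> exists2 C : R, 0 <= C &
  forall n t, t <= T -> `|picard n.+1 t - picard n t| <= C / 2 ^+ n.
Proof.
move=> T0; have [l l0 vl] := volterra_contracting T0.
have [c cT cmax] : exists2 c, c \in `[0, T] & forall t, t \in `[0, T] ->
    `|picard 1 t - picard 0 t| <= `|picard 1 c - picard 0 c|.
  apply: EVT_max => //; apply: continuous_subspaceT => t.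
  by apply: cvg_norm; apply: cvgB; exact: picard_continuous.
pose K := `|picard 1 c - picard 0 c|.
have H n t : 0 <= t <= T ->
    `|picard n.+1 t - picard n t| <= K / 2 ^+ n * expR (l * t).
  elim: n t => [|n IH] t /andP[t0 tT].
    rewrite divr1 (le_trans (cmax t _)) ?in_itv/= ?t0//.
    by rewrite -[leLHS]mulr1 ler_wpM2l// -expR0 ler_expR mulr_ge0.
  have -> : K / 2 ^+ n.+1 = K / 2 ^+ n / 2 by rewrite exprS; field; rewrite expf_neq0.
  apply: vl => //; [exact: (@picard_continuous n.+1)|exact: picard_continuous| |].
    by rewrite divr_ge0 ?normr_ge0// exprn_ge0.
  by rewrite t0.
exists (K * expR (l * T)); first by rewrite mulr_ge0 ?normr_ge0 ?expR_ge0.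
move=> n t tT; have p2 : 0 < 2 ^+ n :> R by rewrite exprn_gt0.
have [t0|t0] := leP 0 t; last first.
  have t0' := ltW t0; have p2' := ltW p2.
  rewrite !picard_neg// subrr normr0 divr_ge0//.
  by rewrite mulr_ge0 ?normr_ge0 ?expR_ge0.
have p2' := ltW p2; rewrite [leRHS]mulrAC; apply: (le_trans (H n t _)); first by rewrite t0.
apply: ler_wpM2l; first by rewrite divr_ge0 ?normr_ge0.
by rewrite ler_expR; exact: ler_wpM2l.
Qed.

Lemma picard_cauchy T : 0 <= T -> exists C : R,
  forall n m t, (n <= m)%N -> t <= T -> `|picard m t - picard n t| <= C / 2 ^+ n.
Proof.
move=> T0; have [C C0 HC] := picardS_bound T0; exists (2 * C) => n m t.
move=> /subnKC <- tT; move: (m - n)%N => j {m}.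
have p2 k : 0 < 2 ^+ k :> R by rewrite exprn_gt0.
apply: (@le_trans _ _ (2 * C / 2 ^+ n - 2 * C / 2 ^+ (n + j))); last first.
  by have := ltW (p2 (n + j)%N) => p2'; rewrite lerBlDr lerDl divr_ge0// mulr_ge0.
elim: j => [|j IH]; first by rewrite addn0 !subrr normr0.
rewrite addnS -(subrKA (picard (n + j) t)) (le_trans (ler_normD _ _))//.
have := HC (n + j)%N t tT.
have -> : 2 * C / 2 ^+ (n + j).+1 = C / 2 ^+ (n + j).
  by rewrite exprS; field; rewrite expf_neq0.
by lra.
Qed.

Definition picard_lim t := lim (picard n t @[n --> \oo]).

Lemma picard_lim_bound T : 0 <= T -> exists C : R,
  forall n t, t <= T -> `|picard_lim t - picard n t| <= C / 2 ^+ n.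
Proof.
move=> T0; have [C HC] := picard_cauchy T0; exists C => n t tT.
have ct : cvg (picard n t @[n --> \oo]).
  apply/cauchy_cvgP/cauchy_exP => e e0.
  have [k Ck] := exists_expn2_lt C e0; exists (picard k t); exists k => // m /= km.
  rewrite /ball/= distrC (le_lt_trans _ Ck)// HC//.
have : `|picard m t - picard n t| @[m --> \oo] --> `|picard_lim t - picard n t|.
  by apply: cvg_norm; apply: cvgB => //; exact: cvg_cst.
move=> /cvgr_to_le; apply; exists n => // m /= nm; exact: HC.
Qed.

Lemma picard_lim_continuous : continuous picard_lim.
Proof.
move=> t; apply/cvgrPdist_lt => e e0.
have T0 : 0 <= `|t| + 1 by rewrite addr_ge0.
have [C HC] := picard_lim_bound T0.
have e30 : 0 < e / 3 by rewrite divr_gt0.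
have [n Cn] := exists_expn2_lt C e30.
have tT : t < `|t| + 1 by rewrite (le_lt_trans (ler_norm t))// ltrDl.
have /cvgrPdist_lt /(_ _ e30) cn := @picard_continuous n t.
near=> s.
have sT : s <= `|t| + 1 by apply: ltW; near: s; exact: lt_nbhsl.
have h1 := HC n t (ltW tT); have h2 := HC n s sT.
have h3 : `|picard n t - picard n s| < e / 3 by near: s; exact: cn.
have -> : picard_lim t - picard_lim s = (picard_lim t - picard n t) +
   (picard n t - picard n s) + - (picard_lim s - picard n s) by ring.
rewrite (le_lt_trans (ler_normD _ _))// normrN.
by have := ler_normD (picard_lim t - picard n t) (picard n t - picard n s); lra.
Unshelve. all: by end_near. Qed.

(** The interval [0, T] and its contraction weight vary with T, but the Picard
    iterates do not, so that their limit solves the equation for all t >= 0. *)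
Theorem volterra_fixpoint : exists2 y, continuous y &
  forall t, 0 <= t -> y t = b t + prim (N y) t.
Proof.
exists picard_lim; first exact: picard_lim_continuous.
move=> t t0; apply/eqP; rewrite -subr_eq0 -normr_le0.
have [C HC] := picard_lim_bound t0; have [L L0 NL] := Nlip t.
apply: (@le0_expn2 (C + L * C * t)) => n.
have cl := picard_lim_continuous; have cp := @picard_continuous n.
have h1 := HC n.+1 t (lexx t).
have h2 : `|volterra (picard n) t - volterra picard_lim t| <= L * (C / 2 ^+ n) * t.
  apply: (le_trans (volterraB cp cl t0)).
  pose F s := `|N (picard n) s - N picard_lim s|.
  have lF : locint F.
    apply: locint_continuous => s.
    by apply: cvg_norm; apply: cvgB; exact: Ncont.
  have := @ler_primB_cst R F (L * (C / 2 ^+ n)) 0 t lF (lexx 0) t0.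
  rewrite [prim _ 0]prim_le0// !subr0; apply.
  move=> s /andP[s0 st]; apply: NL => //; first by rewrite ltW.
  by move=> r /andP[r0 rs]; rewrite distrC HC// (le_trans rs).
have p2 : 0 < 2 ^+ n :> R by rewrite exprn_gt0.
have h3 : C / 2 ^+ n.+1 <= C / 2 ^+ n.
  have C0 : 0 <= C / 2 ^+ n by exact: le_trans (HC n t (lexx t)).
  rewrite exprS invfM mulrA mulrAC; lra.
have -> : picard_lim t - (b t + prim (N picard_lim) t) =
  (picard_lim t - picard n.+1 t) + (volterra (picard n) t - volterra picard_lim t).
  by rewrite /= /volterra; ring.
rewrite (le_trans (ler_normD _ _))//.
have -> : (C + L * C * t) / 2 ^+ n = C / 2 ^+ n + L * (C / 2 ^+ n) * t by ring.
by lra.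
Qed.

End Picard.

(** * Existence of solutions *)

Section Existence.
Context {R : realType}.
Variables (mu gamma : R).
Hypotheses (mu0 : 0 < mu) (gamma0 : 0 < gamma).

(** The second component of the vector field without its input. *)
Definition accel (a b : R) : R := - ((gamma * a + `|b| * b) / Num.max mu `|a|).

Let mx (a : R) : R := Num.max mu `|a|.

Let mx_ge (a : R) : mu <= mx a. Proof. by rewrite /mx le_max lexx. Qed.

Let mx_gt0 (a : R) : 0 < mx a. Proof. exact: lt_le_trans (mx_ge a). Qed.

Let mx_norm (a : R) : `|a| <= mx a. Proof. by rewrite /mx le_max lexx orbT. Qed.

Let mx_lip (a a' : R) : `|mx a' - mx a| <= `|a - a'|.
Proof.
have := ler_dist_dist a a'; rewrite /mx distrC.
have := normr_ge0 (a - a').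
by rewrite !ler_norml; case: (leP mu `|a|) => ?; case: (leP mu `|a'|) => ? ? /andP[? ?];
  apply/andP; split; lra.
Qed.

(** The constant grows with the bound M on the velocities because the damping is
    quadratic: the field is locally but not globally Lipschitz. *)
Lemma accel_lip (M a a' b b' : R) : 0 <= M -> `|b| <= M -> `|b'| <= M ->
  `|accel a b - accel a' b'| <=
  (gamma * `|a - a'| + 2 * M * `|b - b'|) / mu
  + (gamma + M ^+ 2 / mu) * (`|a - a'| / mu).
Proof.
move=> M0 bM bM'; rewrite /accel -!/(mx _).
set p := gamma * a + _; set p' := gamma * a' + _.
have ma := mx_gt0 a; have ma' := mx_gt0 a'.
have -> : - (p / mx a) - - (p' / mx a') =
   - ((p - p') / mx a + (p' / mx a') * ((mx a' - mx a) / mx a)).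
  by field; rewrite !gt_eqF.
have imu : (mx a)^-1 <= mu^-1 by rewrite lef_pV2 ?posrE.
have imu' : (mx a')^-1 <= mu^-1 by rewrite lef_pV2 ?posrE.
have ia : 0 <= (mx a)^-1 by rewrite invr_ge0 ltW.
have ia' : 0 <= (mx a')^-1 by rewrite invr_ge0 ltW.
rewrite normrN (le_trans (ler_normD _ _))// lerD//.
  rewrite normrM (ger0_norm ia) ler_pM//.
  have -> : p - p' = gamma * (a - a') + (`|b| * (b - b') + (`|b| - `|b'|) * b').
    by rewrite /p /p'; ring.
  rewrite (le_trans (ler_normD _ _))// normrM gtr0_norm// lerD2l.
  rewrite (le_trans (ler_normD _ _))// !normrM normr_id.
  have h1 : `|b| * `|b - b'| <= M * `|b - b'| by rewrite ler_wpM2r.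
  have h2 : `| `|b| - `|b'| | * `|b'| <= `|b - b'| * M.
    by rewrite ler_pM// ler_dist_dist.
  by lra.
rewrite normrM ler_pM//; last first.
  by rewrite normrM (ger0_norm ia) ler_pM.
rewrite /p' mulrDl (le_trans (ler_normD _ _))// lerD//.
  rewrite !normrM (ger0_norm ia') (gtr0_norm gamma0) -mulrA ger_pMr//.
  by rewrite ler_pdivrMr// mul1r.
rewrite !normrM normr_id (ger0_norm ia') ler_pM ?mulr_ge0// expr2.
by rewrite ler_pM.
Qed.

(** For b >= 0 the damping has the favourable sign and the restoring force is
    at most gamma.  This bound on the growth of x2 does not depend on b. *)
Lemma accel_le (a b : R) : 0 <= b -> accel a b <= gamma.
Proof.
move=> b0; rewrite /accel -/(mx a) -mulNr ler_pdivrMr// opprD.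
have h1 : - (gamma * a) <= gamma * mx a.
  have := mx_norm a; rewrite ler_norml => /andP[h _].
  by rewrite -mulrN ler_pM2l// lerNl.
have h2 : 0 <= `|b| * b by rewrite mulr_ge0.
by lra.
Qed.

Lemma accel_odd (a b : R) : accel (- a) (- b) = - accel a b.
Proof. by rewrite /accel !normrN !mulrN -opprD mulNr. Qed.

Lemma accel_continuous (f g : R -> R) : continuous f -> continuous g ->
  continuous (fun s => accel (f s) (g s)).
Proof.
move=> cf cg t; apply: cvgN; apply: cvgM.
  apply: cvgD; apply: cvgM; [exact: cvg_cst|exact: cf| |exact: cg].
  by apply: cvg_norm; exact: cg.
apply: (@continuousV _ _ (fun s => Num.max mu `|f s|)).
  by rewrite gt_eqF//; exact: mx_gt0.
apply: (@continuous_max _ _ (fun=> mu) (fun s => `|f s|)); first exact: cvg_cst.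
by apply: cvg_norm; exact: cf.
Qed.

Definition clamp (M y : R) : R := Num.max (- M) (Num.min M y).

Lemma clampE (M y : R) : `|y| <= M -> clamp M y = y.
Proof.
rewrite ler_norml /clamp => /andP[h1 h2].
by rewrite min_r// max_r.
Qed.

Lemma norm_clamp (M y : R) : 0 <= M -> `|clamp M y| <= M.
Proof.
move=> M0; rewrite ler_norml /clamp.
by case: (leP M y) => ?; [case: (leP (- M) M)|case: (leP (- M) y)] => ?;
  apply/andP; split; lra.
Qed.

Lemma clamp_lip (M y z : R) : 0 <= M -> `|clamp M y - clamp M z| <= `|y - z|.
Proof.
move=> M0; have := lexx `|y - z|; rewrite {1}ler_norml => /andP[? ?].
rewrite ler_norml /clamp.
by case: (leP M y) => ?; [case: (leP (- M) M)|case: (leP (- M) y)] => ?;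
  (case: (leP M z) => ?; [case: (leP (- M) M)|case: (leP (- M) z)] => ?);
  apply/andP; split; lra.
Qed.

(** Solutions with globally continuous components, whose input contributes a
    separate integral. *)
Definition trajectory (d x1 x2 : R -> R) :=
  [/\ continuous x1, continuous x2,
      forall t, 0 <= t -> x1 t = x1 0 + prim x2 t
    & forall t, 0 <= t ->
        x2 t = x2 0 + (prim (fun s => accel (x1 s) (x2 s)) t + prim d t)].

Variables (d : R -> R) (ld : locint d).

(** The velocity is the unknown of a Volterra equation in which the damping sees
    the velocity clamped to M(t) = |x02| + gamma t + int_0^t |d|.  The one-sided
    bound on the acceleration shows that |x2| <= M, so that the clamp is
    never active. *)
Lemma trajectory_exists (x01 x02 : R) : exists x1 x2 : R -> R,
  [/\ trajectory d x1 x2, x1 0 = x01 & x2 0 = x02].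
Proof.
pose P := prim (fun s => `|d s|).
have lnd := locint_norm ld.
pose M t : R := `|x02| + gamma * t + P t.
have P0 : P 0 = 0 by rewrite /P prim_le0.
have PB a h : 0 <= a -> 0 <= h -> `|prim d (a + h) - prim d a| <= P (a + h) - P a.
  by move=> a0 h0; apply: ler_norm_primB => //; rewrite lerDl.
have P_homo a h : 0 <= a -> 0 <= h -> P a <= P (a + h).
  by move=> a0 h0; rewrite -subr_ge0 (le_trans _ (PB a h a0 h0)).
have M_homo s t : 0 <= s -> s <= t -> M s <= M t.
  move=> s0 st; have := P_homo s (t - s) s0; rewrite subr_ge0 addrC subrK => /(_ st).
  by rewrite /M; have : gamma * s <= gamma * t by [rewrite ler_pM2l|]; lra.
have M0 t : 0 <= t -> 0 <= M t.
  move=> t0; apply: le_trans (M_homo 0 t (lexx 0) t0).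
  by rewrite /M P0 mulr0 !addr0.
have cM : continuous M.
  move=> t; apply: cvgD; last exact: prim_continuous.
  by apply: cvgD; [exact: cvg_cst|apply: cvgM; [exact: cvg_cst|exact: cvg_id]].
pose X (y : R -> R) t : R := x01 + prim y t.
have cX y : continuous y -> continuous (X y).
  move=> cy t; apply: cvgD; first exact: cvg_cst.
  exact/prim_continuous/locint_continuous.
pose N (y : R -> R) t := accel (X y t) (clamp (M t) (y t)).
have cN y : continuous y -> continuous (N y).
  move=> cy; apply: accel_continuous; first exact: cX.
  move=> t; apply: (@continuous_max _ _ (fun t => - M t)).
    by apply: cvgN; exact: cM.
  by apply: (@continuous_min _ _ M y); [exact: cM|exact: cy].
have Nlip (T : R) : exists2 L : R, 0 <= L &
  forall y z : R -> R, continuous y -> continuous z -> forall s K : R, 0 <= s <= T ->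
    (forall r : R, 0 <= r <= s -> `|y r - z r| <= K) -> `|N y s - N z s| <= L * K.
  have [T0|T0] := ltP T 0.
    exists 0 => // y z _ _ s K /andP[s0 sT].
    by have := le_trans s0 sT; rewrite leNgt T0.
  have g0 := ltW gamma0; have m0 := ltW mu0.
  have MT := M0 T T0; have iMT : 0 <= M T ^+ 2 / mu by rewrite divr_ge0 ?sqr_ge0.
  exists ((gamma * T + 2 * M T * 1) / mu + (gamma + M T ^+ 2 / mu) * (T / mu)).
    apply: addr_ge0; last by rewrite mulr_ge0 ?addr_ge0 ?divr_ge0 ?sqr_ge0.
    by apply: divr_ge0 => //; apply: addr_ge0; rewrite !mulr_ge0.
  move=> y z cy cz s K /andP[s0 sT] yz.
  have K0 : 0 <= K by apply: le_trans (yz s _) => //; rewrite s0 lexx.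
  have MsT := M_homo s T s0 sT; have Ms := M0 s s0.
  have c1 := le_trans (norm_clamp (y s) Ms) MsT.
  have c2 := le_trans (norm_clamp (z s) Ms) MsT.
  apply: (le_trans (accel_lip (X y s) (X z s) MT c1 c2)).
  have hX : `|X y s - X z s| <= T * K.
    rewrite /X opprD addrACA subrr add0r.
    have ly := locint_continuous cy; have lz := locint_continuous cz.
    have lNz : locint (fun s => - z s).
      by apply: locint_continuous => u; apply: cvgN; exact: cz.
    have lyz := locintD ly lNz.
    have := ler_norm_primB lyz (lexx 0) s0.
    rewrite ![prim _ 0]prim_le0// !subr0 primD// primN// => /le_trans; apply.
    have := @ler_primB_cst R (fun s => `|y s - z s|) K 0 s (locint_norm lyz) (lexx 0) s0.
    rewrite [prim _ 0]prim_le0// !subr0 => /(_ _) /le_trans -> //.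
      by move=> u /andP[u0 us]; apply: yz; rewrite us ltW.
    by rewrite mulrC ler_wpM2r.
  have hc : `|clamp (M s) (y s) - clamp (M s) (z s)| <= K.
    by apply: (le_trans (clamp_lip _ _ Ms)); apply: yz; rewrite s0 lexx.
  have -> : ((gamma * T + 2 * M T * 1) / mu + (gamma + M T ^+ 2 / mu) * (T / mu)) * K
    = (gamma * (T * K) + 2 * M T * K) / mu + (gamma + M T ^+ 2 / mu) * (T * K / mu).
    by ring.
  have imu : 0 <= mu^-1 by rewrite invr_ge0.
  apply: lerD; last by rewrite ler_wpM2l ?addr_ge0 ?ler_wpM2r.
  rewrite ler_wpM2r// lerD//; first by rewrite ler_wpM2l.
  by rewrite ler_wpM2l// mulr_ge0.
have cb : continuous (fun t => x02 + prim d t).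
  by move=> t; apply: cvgD; [exact: cvg_cst|exact: prim_continuous].
have [y cy yE] := volterra_fixpoint cb cN Nlip.
have P0d : prim d 0 = 0 by rewrite prim_le0.
have y0 : y 0 = x02 by rewrite yE// P0d prim_le0// !addr0.
(* The signs e = 1 and e = -1 give the two halves of |y| <= M; accel is odd. *)
have half (e : R) : (e = 1 \/ e = -1) -> forall T, 0 <= T -> e * y T - M T <= 0.
  move=> e1 T T0; apply: (@dini_le0 R (fun t => e * y t - M t)) => //.
  - move=> t _; apply: cvgB; last exact: cM.
    by apply: cvgM; [exact: cvg_cst|exact: cy].
  - rewrite y0 /M mulr0 P0 !addr0 subr_le0.
    by case: e1 => ->; rewrite ?mul1r ?mulN1r; [|rewrite -normrN]; exact: ler_norm.
  move=> t /andP[t0 _] wt eps eps0.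
  have Mt := M0 t t0.
  have yt : 0 <= e * clamp (M t) (y t).
    have : M t < e * y t by lra.
    rewrite /clamp; case: e1 => ->; rewrite ?mul1r ?mulN1r => Myt.
      by rewrite le_max (_ : 0 <= Num.min _ _) ?orbT// le_min Mt (le_trans Mt)// ltW.
    by rewrite max_l ?opprK// ge_min; apply/orP; right; lra.
  have Nt : e * N y t <= gamma.
    case: e1 yt => ->; rewrite ?mul1r ?mulN1r => yt; first exact: accel_le.
    by rewrite /N -accel_odd accel_le.
  have := @expands_prim R (fun=> 0) (N y) t (cN y cy) t0 eps eps0.
  apply: filter_app; near=> h.
  have h0 : 0 < h by near: h; exact: nbhs_right_gt.
  have h0' := ltW h0.
  rewrite mulr0 addr0 => HN.
  have dP := PB t h t0 h0'.
  have -> : e * y (t + h) - M (t + h) - (e * y t - M t) =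
     e * (prim (N y) (t + h) - prim (N y) t) + e * (prim d (t + h) - prim d t)
     - gamma * h - (P (t + h) - P t).
    by rewrite !yE ?addr_ge0// /M; ring.
  move: HN dP; rewrite !ler_norml => /andP[? ?] /andP[? ?].
  have : e * N y t * h <= gamma * h by rewrite ler_pM2r.
  by case: e1 => -> ?; lra.
have My t : 0 <= t -> `|y t| <= M t.
  move=> t0; have := half 1 (or_introl erefl) t t0.
  have := half (-1) (or_intror erefl) t t0.
  by rewrite ler_norml => ? ?; apply/andP; split; lra.
exists (X y), y; split=> //; last by rewrite /X prim_le0 ?addr0.
split=> //; first exact: cX.
- by move=> t t0; rewrite /X [prim _ 0]prim_le0// addr0.
move=> t t0; rewrite y0 yE// -addrA; congr (_ + _); rewrite addrC; congr (_ + _).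
by apply: eq_prim => s /andP[s0 _]; rewrite /N clampE// My.
Unshelve. all: by end_near. Qed.

Lemma solution_exists (x0 : R * R) : exists x, is_solution (sys mu gamma) x0 d x.
Proof.
have [x1 [x2 [[c1 c2 E1 E2] i1 i2]]] := trajectory_exists x0.1 x0.2.
exists (fun t => (x1 t, x2 t)) => t t0; rewrite /sys /=.
have la : locint (fun s => accel (x1 s) (x2 s)).
  exact/locint_continuous/accel_continuous.
split.
- exact: (locint_continuous c2).
- exact: (locintD la ld).
- by rewrite E1// [in X in (_, X)]E2// i1 i2 -primD.
Qed.

Lemma solution_trajectory (x0 : R * R) x : is_solution (sys mu gamma) x0 d x ->
  exists x1 x2, [/\ trajectory d x1 x2, x1 0 = x0.1, x2 0 = x0.2 &
    forall t, 0 <= t -> x t = (x1 t, x2 t)].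
Proof.
move=> sx.
have l1 : locint (fun s => (x s).2) by move=> t /sx[].
have l2 : locint (fun s => (sys mu gamma (x s) (d s)).2) by move=> t /sx[].
pose x1 t := x0.1 + prim (fun s => (x s).2) t.
pose x2 t := x0.2 + prim (fun s => (sys mu gamma (x s) (d s)).2) t.
have xE t : 0 <= t -> x t = (x1 t, x2 t) by move=> /sx[_ _ ->].
have c1 : continuous x1.
  by move=> t; apply: cvgD; [exact: cvg_cst|exact: prim_continuous].
have c2 : continuous x2.
  by move=> t; apply: cvgD; [exact: cvg_cst|exact: prim_continuous].
have x10 : x1 0 = x0.1 by rewrite /x1 prim_le0 ?addr0.
have x20 : x2 0 = x0.2 by rewrite /x2 prim_le0 ?addr0.
exists x1, x2; split=> //; split=> // t t0.
  rewrite x10 /x1; congr (_ + _); apply: eq_prim => s /andP[s0 _].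
  by rewrite xE.
rewrite x20 /x2 -primD//; last exact/locint_continuous/accel_continuous.
congr (_ + _); apply: eq_prim => s /andP[s0 _].
by rewrite xE.
Qed.

End Existence.

(** * The Lyapunov function along trajectories *)

Section LyapunovSlope.
Context {R : realType}.
Variables (mu gamma : R).
Hypotheses (mu0 : 0 < mu) (gamma0 : 0 < gamma).
Variables (d : R -> R) (ld : locint d).
Let P := prim (fun s => `|d s|).
Variable N : R.
Hypothesis PN : forall a b : R, 0 <= a -> a <= b -> P b - P a <= N * (b - a).

(** Frequency of the small oscillations, the time scale of the system. *)
Definition freq : R := Num.sqrt (gamma / mu).

Lemma freq_gt0 : 0 < freq.
Proof. by rewrite sqrtr_gt0 divr_gt0. Qed.

Lemma freq_sqr : gamma = mu * freq ^+ 2.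
Proof.
rewrite sqr_sqrtr ?divr_ge0// ?ltW//; first by field; rewrite gt_eqF.
Qed.

Definition scaled_lyap (x : R * R) : R := lyap (x.1 / mu) (x.2 / (mu * freq)).

(** The scaled field has no parameter but its factor freq, because
    gamma = mu freq^2. *)
Lemma accel_scaled (a b : R) : accel mu gamma a b / (mu * freq) =
  freq * - ((a / mu + `|b / (mu * freq)| * (b / (mu * freq))) / msat (a / mu)).
Proof.
have f0 := freq_gt0; have mf0 : 0 < mu * freq by rewrite mulr_gt0.
have -> : accel mu gamma a b =
    - ((mu * freq ^+ 2 * a + `|b| * b) / (mu * msat (a / mu))).
  rewrite /accel -freq_sqr; congr (- (_ / _)).
  rewrite /msat maxr_pMr ?ltW// mulr1 normrM normfV (gtr0_norm mu0).
  by rewrite mulrCA mulfV ?gt_eqF// mulr1.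
have m0 := msat_gt0 (a / mu).
by rewrite normrM normfV (gtr0_norm mf0); field; rewrite !gt_eqF.
Qed.

Lemma expands_coef (A F : R -> R) (F0 a b a' b' : R) : a = a' -> b = b' ->
  expands A F F0 a b -> expands A F F0 a' b'.
Proof. by move=> -> ->. Qed.

Lemma is_derive_inv (x : R) : x != 0 -> is_derive x 1 (fun y => y^-1) (- x ^- 2).
Proof.
move=> x0; have := @is_deriveV R id x 1 1 x0 (is_derive_id _ _).
by rewrite /GRing.scale/= mulr1.
Qed.

Variables (x1 x2 : R -> R).
Hypothesis tr : trajectory mu gamma d x1 x2.

Let Z t := scaled_lyap (x1 t, x2 t).
Let E t := energy (x1 t / mu) (x2 t / (mu * freq)).

(** The chain rule for lyap, with expansions in place of derivatives.  Its
    coefficients are freq times lyap_drift along h and freq / gamma times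
    lyap_gain along the input increment. *)
Lemma lyap_slope t : 0 <= t -> 0 < E t -> forall e, 0 < e ->
  \forall h \near (0 : R)^'+, Z (t + h) - Z t <=
    (- (freq / 160 * prate (Z t)) + e) * h + 2 * freq / gamma * (P (t + h) - P t).
Proof.
move=> t0 E0 e e0; have [c1 c2 E1 E2] := tr.
have f0 := freq_gt0; have mf0 : 0 < mu * freq by rewrite mulr_gt0.
pose A h := prim d (t + h) - prim d t.
have AP h : 0 <= h -> `|A h| <= P (t + h) - P t.
  by move=> h0; apply: ler_norm_primB => //; rewrite lerDl.
have AN : \forall h \near (0 : R)^'+, `|A h| <= N * h.
  near=> h; have h0 : 0 < h by near: h; exact: nbhs_right_gt.
  apply: (le_trans (AP h (ltW h0))).
  have th : t <= t + h by rewrite lerDl ltW.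
  by have := PN t0 th; rewrite [t + h - t]addrAC subrr add0r.
have near_eq F G F0 a b : (forall h, 0 <= h -> G h = F h) ->
    expands A F F0 a b -> expands A G F0 a b.
  move=> FG Fa eps eps0; apply: filter_app (Fa eps eps0); near=> h.
  by have h0 : 0 < h by [near: h; exact: nbhs_right_gt]; rewrite FG// ltW.
set X1 := x1 t / mu; set X2 := x2 t / (mu * freq).
set g := - ((X1 + `|X2| * X2) / msat X1).
have ex1 : expands A (fun h => x1 (t + h) / mu) X1 (freq * X2) 0.
  apply: (@near_eq (fun h => (x1 0 + prim x2 (t + h)) * mu^-1)).
    by move=> h h0; rewrite (E1 (t + h))// addr_ge0.
  rewrite /X1 (E1 t t0); apply: expands_coef; last first.
    apply: (expandsM AN _ (expands_cst _ _)).
    by apply: (expandsD (expands_cst _ _)); exact: expands_prim.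
  - by rewrite /= mulr0 !addr0 mul0r.
  - by rewrite /X2; field; rewrite !gt_eqF.
have eA : expands A (fun h => prim d (t + h)) (prim d t) 0 1.
  move=> eps eps0; near=> h; have h0 : 0 < h by near: h; exact: nbhs_right_gt.
  by rewrite mul0r add0r mul1r subrr normr0 mulr_ge0// ltW.
have ex2 : expands A (fun h => x2 (t + h) / (mu * freq)) X2 (freq * g) (mu * freq)^-1.
  apply: (@near_eq (fun h => (x2 0 + (prim (fun s => accel mu gamma (x1 s) (x2 s)) (t + h)
       + prim d (t + h))) * (mu * freq)^-1)).
    by move=> h h0; rewrite (E2 (t + h))// addr_ge0.
  rewrite /X2 (E2 t t0); apply: expands_coef; last first.
    apply: (expandsM AN _ (expands_cst _ _)).
    apply: (expandsD (expands_cst _ _)); apply: expandsD eA.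
    by apply: expands_prim => //; exact: accel_continuous.
  - by rewrite /=; ring.
  - by rewrite /= mulr0 !addr0 add0r accel_scaled.
pose dV := 2 * X1 / msat X1 * X2 + 2 * X2 * g.
pose V := energy X1 X2.
have eV : expands A (fun h => energy (x1 (t + h) / mu) (x2 (t + h) / (mu * freq))) V
    (freq * dV) ((mu * freq)^-1 * (2 * X2)).
  apply: expands_coef; last first.
    exact: (expandsD (expandsM AN ex2 ex2) (expands_comp AN (is_derive_qpot X1) ex1)).
  - by rewrite /=; ring.
  - by rewrite /dV; ring.
have eS := expands_comp AN (is_derive1_sqrt E0) eV.
have e1V := expandsD (expands_cst A 1) eV.
have V1 : 1 + V != 0 by rewrite gt_eqF// ltr_wpDr ?energy_ge0.
have eI := expands_comp AN (is_derive_inv V1) e1V.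
have eZ := expandsD eS (expandsM AN (expands_cst A 20^-1) (expandsM AN (expandsM AN ex1 ex2) eI)).
have := expands_le e0 eZ; apply: filter_app; near=> h.
have h0 : 0 < h by near: h; exact: nbhs_right_gt.
rewrite -/(lyap _ _) -/(lyap _ _) -/(scaled_lyap (_, _)) => /le_trans; apply.
have D := lyap_drift E0; have G := lyap_gain E0.
rewrite -/X1 -/X2 -/V -/g -/dV in D G.
have zh := AP h (ltW h0).
have PP : 0 <= P (t + h) - P t by exact: le_trans zh.
apply: lerD.
  rewrite ler_pM2r// lerD2r.
  move: D; rewrite -(ler_pM2l f0) => D.
  apply: le_trans (le_trans D _); last by rewrite /Z /scaled_lyap /= -/X1 -/X2; lra.
  by rewrite le_eqVlt; apply/orP; left; apply/eqP; ring.
rewrite ler_pM//.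
have -> : 2 * freq / gamma = (mu * freq)^-1 * 2.
  by rewrite [in LHS]freq_sqr; field; rewrite !gt_eqF.
set b := (X in `|X| <= _).
have -> : b = (mu * freq)^-1 * ((2 * Num.sqrt V)^-1 * (2 * X2)
    + 20^-1 * (X1 / (1 + V) + X1 * X2 * (- (1 + V) ^- 2 * (2 * X2)))).
  by rewrite /b; ring.
have bp : 0 < (mu * freq)^-1 by rewrite invr_gt0.
by rewrite normrM (gtr0_norm bp) ler_pM2l.
Unshelve. all: by end_near. Qed.

End LyapunovSlope.

(** * Essentially bounded inputs *)

Section EssentialNorm.
Context {R : realType}.
Notation mu := (@lebesgue_measure R).
Implicit Types (d : R -> R) (I : interval R).

Let aeS (A B : R -> Prop) : (forall s, A s -> B s) ->
  {ae mu, forall s, A s} -> {ae mu, forall s, B s}.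
Proof. exact: (@filterS _ _ (ae_filter_ringOfSetsType mu)). Qed.

Lemma essnorm_le_ae I d (M : \bar R) : (essnorm I d <= M)%E ->
  {ae mu, forall s, [set` I] s -> (`|d s|%:E <= M)%E}.
Proof.
move=> /ess_supP [N [mN N0 dN]]; exists (N `&` [set` I]); split.
- by apply: measurableI => //; exact: measurable_itv.
- exact: N0.
- by move=> s /= /existsNP[Is ds]; split => //; exact: dN.
Qed.

Lemma ae_essnorm_le I d (M : \bar R) :
  {ae mu, forall s, [set` I] s -> (`|d s|%:E <= M)%E} -> (essnorm I d <= M)%E.
Proof.
move=> [N [mN N0 dN]]; apply/ess_supP; exists (N `|` ~` [set` I]); split.
- by apply: measurableU => //; apply: measurableC; exact: measurable_itv.
- rewrite /= /mrestr setIUl setICl setU0; apply/eqP; rewrite -measure_le0 -N0.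
  apply: le_measure; [|by rewrite inE|by move=> ? []].
  by rewrite inE; apply: measurableI => //; exact: measurable_itv.
- move=> s /= ds; have [Is|] := pselect ([set` I] s); last by right.
  by left; apply: dN => /= /(_ Is).
Qed.

Lemma essnorm_subset I J d : [set` I] `<=` [set` J] -> (essnorm I d <= essnorm J d)%E.
Proof.
move=> IJ; apply: ae_essnorm_le; apply: aeS (essnorm_le_ae (lexx (essnorm J d))).
by move=> s dJ /IJ.
Qed.

Lemma essnorm_ge0 I d : (0 < mu [set` I])%E -> (0 <= essnorm I d)%E.
Proof.
move=> I0; apply: ess_sup_ger => //=.
by rewrite /mrestr setTI.
Qed.

Lemma essnorm_half_fin_num (t : R) d : 0 < t -> Linfty d ->
  (essnorm `[0%R, t[ d \is a fin_num)%E.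
Proof.
move=> t0 [_ dfin]; rewrite ge0_fin_numE.
  apply: le_lt_trans dfin; apply: essnorm_subset => s /=.
  by rewrite !in_itv/= => /andP[->].
by apply: essnorm_ge0; rewrite lebesgue_measure_itv/= lte_fin t0 -EFinD lte_fin subr0.
Qed.

Lemma Linfty_bound d : Linfty d -> exists2 M : R, 0 <= M &
  {ae mu, forall s, 0 <= s -> `|d s| <= M}.
Proof.
move=> [_ dfin]; pose m : \bar R := maxe 0%E (essnorm `[0%R, +oo[ d).
have m0 : (0 <= m)%E by rewrite /m le_max lexx.
have mfin : m \is a fin_num by rewrite ge0_fin_numE// /m gt_max ltry.
exists (fine m); first exact: fine_ge0.
have : (essnorm `[0%R, +oo[ d <= m)%E by rewrite /m le_max lexx orbT.
move=> /essnorm_le_ae; apply: aeS => s + s0.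
by rewrite /= in_itv/= s0 => /(_ isT); rewrite -(fineK mfin) lee_fin.
Qed.

Lemma Linfty_locint d : Linfty d -> locint d.
Proof.
move=> dL; have [M M0 dM] := Linfty_bound dL; have [md _] := dL => t t0.
have sub : (`[0, t]%classic : set R) `<=` `[0, +oo[%classic.
  by move=> s /=; rewrite !in_itv/= => /andP[->].
have mdt : measurable_fun `[0, t] d by apply: measurable_funS md.
apply/integrableP; split; first exact/measurable_realfun.measurable_EFinP.
have := @integral_le_bound _ _ _ mu `[0, t]%classic (EFin \o d) M%:E.
move=> /(_ (measurable_itv _)) h; apply: le_lt_trans (h _ _ _) _ => //.
- exact/measurable_realfun.measurable_EFinP.
- by apply: aeS dM => s + /sub /=; rewrite in_itv/= andbT lee_fin; exact.
- have mt : (mu `[0%R, t] < +oo)%E.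
    by rewrite lebesgue_measure_itv/=; case: ifP => _; rewrite -?EFinD ltry.
  by apply: lte_mul_pinfty.
Qed.

Lemma prim_norm_lip d (M a b : R) : locint d -> 0 <= M -> 0 <= a -> a <= b ->
    {ae mu, forall s, a < s <= b -> `|d s| <= M} ->
  prim (fun s => `|d s|) b - prim (fun s => `|d s|) a <= M * (b - a).
Proof.
move=> ld M0 a0 ab dM; rewrite (primB (locint_norm ld))//.
have /integrableP[mf foo] := locint_itv ld a0 ab.
have /integrableP[mn noo] := locint_itv (locint_norm ld) a0 ab.
rewrite -lee_fin fineK; last first.
  by apply: integrable_fin_num => //; exact: locint_itv (locint_norm ld) a0 ab.
have -> : ((M * (b - a))%:E = M%:E * mu `]a, b])%E.
  rewrite lebesgue_measure_itv/= lte_fin; case: ifPn => [_|].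
    by rewrite -EFinD -EFinM.
  rewrite -leNgt mule0 => ba; have -> : b - a = 0 by lra.
  by rewrite mulr0.
apply: (@integral_le_bound _ _ _ mu `]a, b]%classic (EFin \o d)) => //.
Qed.

End EssentialNorm.

(** * Comparison functions *)

Section Comparison.
Context {R : realType}.
Implicit Types (k s t : R).

(** Along y = decay k s the derivative is - k y^2 / (1 + s^2).  As y <= s, it is at
    least - k prate y: a rational supersolution of y' = - k prate y, while the
    solution itself involves square roots. *)
Definition decay k s t : R := s * (1 + s ^+ 2) / (1 + s ^+ 2 + k * s * t).

Lemma decay_den k s t : 0 <= k -> 0 <= s -> 0 <= t -> 0 < 1 + s ^+ 2 + k * s * t.
Proof.
move=> k0 s0 t0; have := sqr_ge0 s.
by have : 0 <= k * s * t by [rewrite !mulr_ge0|]; lra.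
Qed.

Lemma decay_ge0 k s t : 0 <= k -> 0 <= s -> 0 <= t -> 0 <= decay k s t.
Proof.
move=> k0 s0 t0; rewrite divr_ge0 ?mulr_ge0//; last exact/ltW/decay_den.
by have := sqr_ge0 s; lra.
Qed.

Lemma decay0 k s : decay k s 0 = s.
Proof.
by rewrite /decay mulr0 addr0 mulfK// gt_eqF//; have := sqr_ge0 s; lra.
Qed.

Lemma decay_le k s t : 0 <= k -> 0 <= s -> 0 <= t -> decay k s t <= s.
Proof.
move=> k0 s0 t0; rewrite ler_pdivrMr ?decay_den// ler_wpM2l//.
by have : 0 <= k * s * t by [rewrite !mulr_ge0|]; lra.
Qed.

Lemma is_derive_decay k s t : 0 <= k -> 0 <= s -> 0 <= t ->
  is_derive t 1 (decay k s) (- (k * (decay k s t ^+ 2 / (1 + s ^+ 2)))).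
Proof.
move=> k0 s0 t0; have D0 := decay_den k0 s0 t0.
have dD : is_derive t 1 (fun t => 1 + s ^+ 2 + k * s * t) (k * s).
  by apply: is_derive_eq; rewrite /GRing.scale/= mulr1 add0r mul1r.
have dI := @is_deriveV R _ t _ 1 (lt0r_neq0 D0) dD.
have dM := @is_deriveZ R R R _ (s * (1 + s ^+ 2)) t 1 _ dI.
apply: is_derive_eq; rewrite /GRing.scale /decay/=; field.
by rewrite !gt_eqF//; have := sqr_ge0 s; lra.
Qed.

(** Where y exceeds decay k s it also decreases faster, prate being
    nondecreasing. *)
Lemma dini_decay k s (y : R -> R) T : 0 <= k -> 0 <= s -> 0 <= T ->
    (forall t, 0 <= t <= T -> {for t, continuous y}) -> y 0 <= s ->
    (forall t, 0 <= t < T -> 0 < y t -> rslope_le y t (- (k * prate (y t)))) ->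
  y T <= decay k s T.
Proof.
move=> k0 s0 T0 cy ys dy; rewrite -subr_le0.
apply: (@dini_le0 R (fun t => y t - decay k s t)) => //.
- move=> t /andP[t0 tT]; apply: cvgB; first by apply: cy; rewrite t0.
  apply/differentiable_continuous/derivable1_diffP.
  exact: (@ex_derive _ _ _ _ _ _ _ (is_derive_decay k0 s0 t0)).
- by rewrite decay0 subr_le0.
- move=> t tT wt; have /andP[t0 _] := tT.
  have B0 := decay_ge0 k0 s0 t0.
  have yt : 0 < y t by lra.
  have dNB := derive_rslope (is_deriveN (is_derive_decay k0 s0 t0)).
  apply: rslope_leW (rslope_leD (dy t tT yt) dNB).
  have h1 : prate (decay k s t) <= prate (y t) by apply: prate_homo => //; lra.
  have h2 : decay k s t ^+ 2 / (1 + s ^+ 2) <= prate (decay k s t).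
    have s2 : 0 < 1 + s ^+ 2 by have := sqr_ge0 s; lra.
    have b2 : 0 < 1 + decay k s t ^+ 2 by have := sqr_ge0 (decay k s t); lra.
    rewrite /prate ler_wpM2l ?sqr_ge0// lef_pV2 ?posrE// lerD2l.
    by rewrite ler_pXn2r ?nnegrE//; exact: decay_le.
  have := ler_wpM2l k0 (le_trans h2 h1); rewrite opprK; lra.
Qed.

Lemma cvg_decay (T : Type) (F : set_system T) {FF : Filter F} (f g : T -> R) k s t :
    0 <= k -> 0 <= s -> 0 <= t -> f x @[x --> F] --> s -> g x @[x --> F] --> t ->
  decay k (f x) (g x) @[x --> F] --> decay k s t.
Proof.
move=> k0 s0 t0 fs gt.
have c1 : 1 + f x ^+ 2 @[x --> F] --> 1 + s ^+ 2.
  by apply: cvgD; [exact: cvg_cst|rewrite expr2; exact: (cvgM fs fs)].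
apply: cvgM; first exact: (cvgM fs c1).
apply: cvgV; first by rewrite gt_eqF// decay_den.
apply: (cvgD c1); apply: cvgM => //.
by apply: cvgM => //; exact: cvg_cst.
Qed.

Lemma decay_incr k r s t : 0 <= k -> 0 <= t -> 0 <= r -> r < s ->
  decay k r t < decay k s t.
Proof.
move=> k0 t0 r0 rs; have s0 : 0 <= s by lra.
have Dr := decay_den k0 r0 t0; have Ds := decay_den k0 s0 t0.
rewrite /decay ltr_pdivrMr// mulrAC ltr_pdivlMr// -subr_gt0.
have -> : s * (1 + s ^+ 2) * (1 + r ^+ 2 + k * r * t) -
   r * (1 + r ^+ 2) * (1 + s ^+ 2 + k * s * t) =
   (s - r) * ((1 + r ^+ 2) * (1 + s ^+ 2) + k * t * (s * r * (s + r))) by ring.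
rewrite mulr_gt0 ?subr_gt0// ltr_wpDr//; first by rewrite !mulr_ge0// addr_ge0.
by have := sqr_ge0 r; have := sqr_ge0 s; move=> ? ?; rewrite mulr_gt0//; lra.
Qed.

Lemma decay_classKL (a k : R) : 0 < a -> 0 < k ->
  classKL (fun s t => decay k (a * s) t).
Proof.
move=> a0 k0; have k0' := ltW k0; have a0' := ltW a0; split.
- apply: continuous_in_subspaceT => -[s t]; rewrite inE/= => -[s0 t0].
  apply: cvg_decay => //=; first by rewrite mulr_ge0.
    by apply: cvgM; [exact: cvg_cst|exact: cvg_fst].
  exact: cvg_snd.
- move=> t t0; split.
  + apply: continuous_in_subspaceT => s; rewrite inE/= in_itv/= andbT => s0.
    apply: cvg_decay => //; first by rewrite mulr_ge0.
      by apply: cvgM; [exact: cvg_cst|exact: cvg_id].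
    exact: cvg_cst.
  + by rewrite /decay mulr0 !mul0r.
  + by move=> r s r0 rs; rewrite decay_incr// ?ltr_pM2l// mulr_ge0.
- move=> s s0; set b := a * s; have b0 : 0 < b by rewrite mulr_gt0.
  have b2 := sqr_ge0 b.
  split.
  + move=> t u t0 tu; have u0 : 0 <= u by lra.
    rewrite /decay ltr_pM2l ?mulr_gt0//; last lra.
    have Dt := decay_den k0' (ltW b0) t0; have Du := decay_den k0' (ltW b0) u0.
    by rewrite ltf_pV2 ?posrE// ltrD2l ltr_pM2l// mulr_gt0.
  + apply/cvgrPdist_le => e e0; near=> t.
    have t0 : 0 < t by near: t; exact: nbhs_pinfty_gt.
    have tb : b * (1 + b ^+ 2) / (k * b * e) <= t.
      by near: t; apply: nbhs_pinfty_ge; exact: num_real.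
    have kb0 : 0 < k * b by rewrite mulr_gt0.
    rewrite sub0r normrN ger0_norm; last by apply: decay_ge0 => //; exact: ltW.
    have D0 := decay_den k0' (ltW b0) (ltW t0).
    rewrite /decay ler_pdivrMr//.
    move: tb; rewrite ler_pdivrMr ?mulr_gt0// => /le_trans; apply.
    have : 0 <= e * (1 + b ^+ 2) by apply: mulr_ge0; [exact: ltW|lra].
    by lra.
Unshelve. all: by end_near. Qed.

Lemma comp_classKL (chi : R -> R) (beta : R -> R -> R) :
    continuous chi -> chi 0 = 0 ->
    (forall r s, 0 <= r -> r < s -> chi r < chi s) ->
  classKL beta -> classKL (fun s t => chi (beta s t)).
Proof.
move=> cc c0 ci [cb Kb Lb]; split.
- by move=> p; apply: continuous_comp; [exact: cb|exact: cc].
- move=> t t0; have [ct t00 ti] := Kb t t0; split.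
  + by move=> s; apply: continuous_comp; [exact: ct|exact: cc].
  + by rewrite t00.
  + move=> r s r0 rs; apply: ci; last exact: ti.
    move: r0; rewrite le_eqVlt => /predU1P[<-|r0]; first by rewrite t00.
    by rewrite -t00 ltW// ti.
- move=> s s0; have [dt lt] := Lb s s0; split.
  + move=> t u t0 tu; apply: ci; last exact: dt.
    have [_ u00 ui] := Kb u (le_trans t0 (ltW tu)).
    by rewrite -u00 ltW// ui.
  + by rewrite -c0; apply: continuous_cvg => //; exact: cc.
Qed.

(** The scaling of the system in quadratic form: x1 may grow like the square of
    the Lyapunov function, x2 like its first power. *)
Definition growth (A z : R) : R := A * (2 * z + 4 * z ^+ 2).

Lemma growth_incr A y z : 0 < A -> 0 <= y -> y < z -> growth A y < growth A z.
Proof.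
move=> A0 y0 yz; rewrite /growth ltr_pM2l//.
have : y ^+ 2 < z ^+ 2 by rewrite ltr_pXn2r ?nnegrE//; lra.
by lra.
Qed.

Lemma growth_homo A y z : 0 < A -> 0 <= y -> y <= z -> growth A y <= growth A z.
Proof.
move=> A0 y0; rewrite le_eqVlt => /predU1P[->//|yz].
exact/ltW/growth_incr.
Qed.

Lemma growth_continuous A : continuous (growth A).
Proof.
move=> z; apply: cvgM; first exact: cvg_cst.
apply: cvgD; first by apply: cvgM; [exact: cvg_cst|exact: cvg_id].
by apply: cvgM; [exact: cvg_cst|rewrite expr2; apply: cvgM; exact: cvg_id].
Qed.

(** A substitute for subadditivity that separates the initial state from the
    input in the ISS estimate. *)
Lemma growthD A y z : 0 <= A -> 0 <= y -> 0 <= z ->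
  growth A (y + z) <= growth A (2 * y) + growth A (2 * z).
Proof.
move=> A0 y0 z0; rewrite /growth -mulrDr ler_wpM2l//.
by have := sqr_ge0 (y - z); have := sqr_ge0 y; have := sqr_ge0 z; lra.
Qed.

(** The nonnegative root z of growth A z = r. *)
Definition growth_inv (A r : R) : R := (Num.sqrt (1 + 4 * (r / A)) - 1) / 4.

Lemma growthK A z : 0 < A -> 0 <= z -> growth_inv A (growth A z) = z.
Proof.
move=> A0 z0; rewrite /growth_inv /growth.
have -> : 1 + 4 * (A * (2 * z + 4 * z ^+ 2) / A) = (1 + 4 * z) ^+ 2.
  by field; rewrite gt_eqF.
by rewrite sqrtr_sqr ger0_norm; [field|lra].
Qed.

Lemma growth_inv_incr A r s : 0 < A -> 0 <= r -> r < s ->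
  growth_inv A r < growth_inv A s.
Proof.
move=> A0 r0 rs; rewrite /growth_inv ltr_pM2r// ltrD2r ltr_sqrt.
  by rewrite ltrD2l ltr_pM2l// ltr_pM2r ?invr_gt0.
by have s0 := le_lt_trans r0 rs; have := divr_gt0 s0 A0; lra.
Qed.

Lemma growth_inv_classKoo A : 0 < A -> classKoo (growth_inv A).
Proof.
move=> A0; split; [split|].
- apply: continuous_subspaceT => r; apply: cvgM; last exact: cvg_cst.
  apply: cvgB; last exact: cvg_cst.
  apply: continuous_cvg; first exact: sqrt_continuous.
  apply: cvgD; first exact: cvg_cst.
  by apply: cvgM; [exact: cvg_cst|apply: cvgM; [exact: cvg_id|exact: cvg_cst]].
- by rewrite /growth_inv mul0r mulr0 addr0 sqrtr1 subrr mul0r.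
- by move=> r s; exact: growth_inv_incr.
- apply/cvgryPge => M; near=> r.
  have : growth A (Num.max M 0) <= r by near: r; apply: nbhs_pinfty_ge; exact: num_real.
  have m0 : 0 <= Num.max M 0 by rewrite le_max lexx orbT.
  have g0 : 0 <= growth A (Num.max M 0).
    have A0' := ltW A0.
    by rewrite /growth mulr_ge0// addr_ge0// mulr_ge0 ?sqr_ge0.
  move=> gr; apply: (@le_trans _ _ (Num.max M 0)); first by rewrite le_max lexx.
  rewrite -[leLHS](growthK A0 m0); move: gr; rewrite le_eqVlt => /predU1P[<-//|gr].
  exact/ltW/growth_inv_incr.
Unshelve. all: by end_near. Qed.

End Comparison.

(** * Integral and small-input estimates *)

Section Estimates.
Context {R : realType}.
Variables (mu gamma : R).
Hypotheses (mu0 : 0 < mu) (gamma0 : 0 < gamma).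
Let f := freq mu gamma.
Let f0 : 0 < f. Proof. exact: freq_gt0. Qed.
Let Z (x : R * R) := scaled_lyap mu gamma x.

Lemma enorm_ge0 (x : R * R) : 0 <= enorm x.
Proof. exact: sqrtr_ge0. Qed.

Lemma enorm_le (x : R * R) : enorm x <= `|x.1| + `|x.2|.
Proof.
rewrite /enorm -(ger0_norm (addr_ge0 (normr_ge0 x.1) (normr_ge0 x.2))) -sqrtr_sqr.
apply: ler_wsqrtr; rewrite -(real_normK (num_real x.1)) -(real_normK (num_real x.2)).
by have : 0 <= `|x.1| * `|x.2| by [rewrite mulr_ge0|]; lra.
Qed.

Lemma norm1_le_enorm (x : R * R) : `|x.1| <= enorm x.
Proof. by rewrite -sqrtr_sqr; apply: ler_wsqrtr; rewrite lerDl sqr_ge0. Qed.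

Lemma norm2_le_enorm (x : R * R) : `|x.2| <= enorm x.
Proof. by rewrite -sqrtr_sqr; apply: ler_wsqrtr; rewrite lerDr sqr_ge0. Qed.

Lemma scaled_lyap_ge0 x : 0 <= Z x.
Proof.
have /andP[+ _] := lyap_bounds (x.1 / mu) (x.2 / (mu * f)).
by apply: le_trans; rewrite mulr_ge0 ?sqrtr_ge0.
Qed.

(** Positivity of the Lyapunov function excludes the origin, the only point where
    it is not differentiable. *)
Lemma scaled_lyap_gt0 x : 0 < Z x -> 0 < energy (x.1 / mu) (x.2 / (mu * f)).
Proof.
have /andP[_ +] := lyap_bounds (x.1 / mu) (x.2 / (mu * f)).
move=> h1 h2; have := lt_le_trans h2 h1.
by rewrite pmulr_lgt0// sqrtr_gt0.
Qed.

Lemma scaled_lyap_le x : Z x <= 2 * (mu^-1 + (mu * f)^-1) * enorm x.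
Proof.
have mf0 : 0 < mu * f by rewrite mulr_gt0.
have /andP[_ h] := lyap_bounds (x.1 / mu) (x.2 / (mu * f)).
apply: (le_trans h).
set X1 := x.1 / mu; set X2 := x.2 / (mu * f).
have v0 := sqrtr_ge0 (energy X1 X2).
have : Num.sqrt (energy X1 X2) <= `|X1| + `|X2|.
  apply: le_trans (enorm_le (X1, X2)); apply: ler_wsqrtr.
  by rewrite /energy /= addrC lerD2r qpot_le_sqr.
have n1 : `|X1| <= mu^-1 * enorm x.
  rewrite /X1 normrM normfV (gtr0_norm mu0) mulrC ler_pM2l ?invr_gt0//.
  exact: norm1_le_enorm.
have n2 : `|X2| <= (mu * f)^-1 * enorm x.
  rewrite /X2 normrM normfV (gtr0_norm mf0) mulrC ler_pM2l ?invr_gt0//.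
  exact: norm2_le_enorm.
by lra.
Qed.

Lemma enorm_le_growth x : enorm x <= growth (mu * (1 + f)) (Z x).
Proof.
have mf0 : 0 < mu * f by rewrite mulr_gt0.
have /andP[h _] := lyap_bounds (x.1 / mu) (x.2 / (mu * f)).
rewrite -[lyap _ _]/(Z x) in h.
apply: (le_trans (enorm_le x)); move: h.
set X1 := x.1 / mu; set X2 := x.2 / (mu * f) => h.
have -> : x.1 = mu * X1 by rewrite /X1; field; rewrite gt_eqF.
have -> : x.2 = mu * f * X2 by rewrite /X2; field; rewrite !gt_eqF.
clearbody X1 X2; rewrite !normrM (gtr0_norm mu0) (gtr0_norm f0).
have v0 := sqrtr_ge0 (energy X1 X2).
have vV : Num.sqrt (energy X1 X2) ^+ 2 = energy X1 X2.
  by rewrite sqr_sqrtr// energy_ge0.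
set v := Num.sqrt _ in h v0 vV.
have z0 := scaled_lyap_ge0 x; move: (Z x) h z0 => z h z0.
have vz : v <= 2 * z by lra.
have n2 : `|X2| <= v.
  by rewrite -sqrtr_sqr; apply: ler_wsqrtr; rewrite /energy lerDl qpot_ge0.
have n1 : `|X1| <= v + v ^+ 2.
  rewrite vV /energy; have [h1|h1] := leP `|X1| 1.
    have q1 : qpot X1 = X1 ^+ 2 by rewrite /qpot h1.
    have : `|X1| <= v.
      by rewrite -sqrtr_sqr; apply: ler_wsqrtr; rewrite /energy q1 lerDr sqr_ge0.
    by have := sqr_ge0 X2; have := sqr_ge0 X1; rewrite q1; lra.
  have q1 : qpot X1 = 2 * `|X1| - 1 by rewrite /qpot leNgt h1.
  by have := sqr_ge0 X2; rewrite q1; lra.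
have v2 : v ^+ 2 <= 4 * z ^+ 2.
  by have -> : 4 * z ^+ 2 = (2 * z) ^+ 2 by [ring|]; rewrite ler_pXn2r ?nnegrE//; lra.
rewrite /growth -!mulrA -mulrDr ler_pM2l// mulrDl mul1r.
have z2 := sqr_ge0 z.
have : f * `|X2| <= f * (2 * z + 4 * z ^+ 2) by rewrite ler_pM2l//; lra.
by lra.
Qed.

Variables (d x1 x2 : R -> R).
Hypotheses (ld : locint d) (tr : trajectory mu gamma d x1 x2).
Let P := prim (fun s => `|d s|).
Variable N : R.
Hypothesis PN : forall a b : R, 0 <= a -> a <= b -> P b - P a <= N * (b - a).

Let z t := Z (x1 t, x2 t).

Let cP : continuous P.
Proof. exact/prim_continuous/locint_norm. Qed.

Let cz : continuous z.
Proof.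
have [c1 c2 _ _] := tr.
have cX1 : continuous (fun t => x1 t / mu).
  by move=> t; apply: cvgM; [exact: c1|exact: cvg_cst].
have cX2 : continuous (fun t => x2 t / (mu * f)).
  by move=> t; apply: cvgM; [exact: c2|exact: cvg_cst].
have cq : continuous (@qpot R).
  move=> y; apply/differentiable_continuous/derivable1_diffP.
  exact: (@ex_derive _ _ _ _ _ _ _ (is_derive_qpot y)).
have cE : continuous (fun t => energy (x1 t / mu) (x2 t / (mu * f))).
  move=> t; apply: cvgD.
    by rewrite expr2; apply: cvgM; exact: cX2.
  by apply: continuous_cvg; [exact: cq|exact: cX1].
move=> t; apply: cvgD.
  by apply: continuous_cvg; [exact: sqrt_continuous|exact: cE].
apply: cvgM; first exact: cvg_cst.
apply: cvgM; first by apply: cvgM; [exact: cX1|exact: cX2].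
apply: cvgV; first by rewrite gt_eqF// ltr_wpDr ?energy_ge0.
by apply: cvgD; [exact: cvg_cst|exact: cE].
Qed.

(** Subtracting the accumulated input leaves a function that decreases no slower
    than it would without input, since the rate at Z is at least the rate at the
    smaller value Z - c P. *)
Lemma lyap_integral_estimate T : 0 <= T ->
  z T <= decay (f / 160) (z 0) T + 2 * f / gamma * P T.
Proof.
move=> T0; set c := 2 * f / gamma; have c0 : 0 <= c by rewrite divr_ge0 ?mulr_ge0 ?ltW.
have [k kE] : exists k, k = f / 160 by exists (f / 160).
have k0 : 0 <= k by rewrite kE; have := f0; lra.
rewrite -kE.
have z0 t : 0 <= z t by exact: scaled_lyap_ge0.
have P0 t : 0 <= t -> 0 <= P t.
  by move=> t0; rewrite /P /prim Rintegral_ge0.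
suff : z T - c * P T <= decay k (z 0) T by lra.
apply: (@dini_decay R _ _ (fun t => z t - c * P t)) => //.
- move=> t _; apply: cvgB; first exact: cz.
  by apply: cvgM; [exact: cvg_cst|exact: cP].
- by rewrite /P prim_le0// mulr0 subr0.
move=> t /andP[t0 _] yt e e0.
have cPt : 0 <= c * P t by rewrite mulr_ge0// P0.
have zt : 0 < z t by lra.
have := lyap_slope mu0 gamma0 ld PN tr t0 (scaled_lyap_gt0 zt) e0.
apply: filter_app; near=> h; have h0 : 0 < h by near: h; exact: nbhs_right_gt.
rewrite -/f -kE -/c -/P -/(Z _) -/(Z _) -/(z t) -/(z (t + h)) => H.
have pr : prate (z t - c * P t) <= prate (z t) by apply: prate_homo; lra.
have : (k * prate (z t - c * P t)) * h <= (k * prate (z t)) * h.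
  by rewrite ler_pM2r// ler_wpM2l.
by lra.
Unshelve. all: by end_near. Qed.

(** The rate at Z is at least the mean of the rates at Z - w and at w, and the
    second half is spent on the input. *)
Lemma lyap_gain_estimate T (delta w : R) : 0 <= T -> 0 <= w ->
    2 * f / gamma * delta <= f / 320 * prate w ->
    (forall a b, 0 <= a -> a <= b -> b < T -> P b - P a <= delta * (b - a)) ->
  z T <= decay (f / 320) (z 0) T + w.
Proof.
have [k kE] : exists k, k = f / 320 by exists (f / 320).
have k0 : 0 <= k by rewrite kE; have := f0; lra.
have kE2 : f / 160 = 2 * k by rewrite kE; lra.
rewrite -kE; move=> T0 w0 dw dP.
have c0 : 0 <= 2 * f / gamma by rewrite divr_ge0 ?mulr_ge0 ?ltW.
have z0 t : 0 <= z t by exact: scaled_lyap_ge0.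
rewrite -lerBlDr.
apply: (@dini_decay R _ _ (fun t => z t - w)) => //.
- by move=> t _; apply: cvgB; [exact: cz|exact: cvg_cst].
- by rewrite gerBl.
move=> t /andP[t0 tT] yt e e0.
have zt : 0 < z t by lra.
have := lyap_slope mu0 gamma0 ld PN tr t0 (scaled_lyap_gt0 zt) e0.
apply: filter_app; near=> h; have h0 : 0 < h by near: h; exact: nbhs_right_gt.
rewrite -/f kE2 -/P -/(Z _) -/(Z _) -/(z t) -/(z (t + h)) => H.
have thT : t + h < T.
  by rewrite -ltrBrDl; near: h; apply: nbhs_right_lt; rewrite subr_gt0.
have th : t <= t + h by rewrite lerDl ltW.
have := dP t (t + h) t0 th thT; rewrite [t + h - t]addrAC subrr add0r => dPh.
have p1 : prate (z t - w) <= prate (z t) by apply: prate_homo; lra.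
have p2 : prate w <= prate (z t) by apply: prate_homo; lra.
have q1 : k * prate (z t - w) * h <= k * prate (z t) * h.
  by rewrite ler_pM2r// ler_wpM2l.
have q2 : k * prate w * h <= k * prate (z t) * h.
  by rewrite ler_pM2r// ler_wpM2l.
have q3 : 2 * f / gamma * delta * h <= k * prate w * h by rewrite ler_pM2r.
have q4 := ler_wpM2l c0 dPh.
by lra.
Unshelve. all: by end_near. Qed.

End Estimates.

Section MainResults.
Context {R : realType}.
Variables (mu gamma : R).
Hypotheses (mu0 : 0 < mu) (gamma0 : 0 < gamma).
Let f := freq mu gamma.
Let f0 : 0 < f. Proof. exact: freq_gt0. Qed.
Let a := 2 * (mu^-1 + (mu * f)^-1).
Let a0 : 0 < a. Proof. by rewrite mulr_gt0// addr_gt0// invr_gt0// mulr_gt0. Qed.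
Let A := mu * (1 + f).
Let A0 : 0 < A. Proof. by rewrite mulr_gt0// addr_gt0. Qed.

Lemma decay_scaled_lyap (k t : R) x : 0 <= k -> 0 <= t ->
  decay k (scaled_lyap mu gamma x) t <= decay k (a * enorm x) t.
Proof.
move=> k0 t0; have := scaled_lyap_le mu0 gamma0 x.
rewrite le_eqVlt => /predU1P[->//|lt]; apply/ltW/decay_incr => //.
exact: scaled_lyap_ge0.
Qed.

Lemma Linfty_prim_lip (d : R -> R) : Linfty d -> exists N : R, forall u v, 0 <= u -> u <= v ->
  prim (fun s => `|d s|) v - prim (fun s => `|d s|) u <= N * (v - u).
Proof.
move=> dL; have [M M0 dM] := Linfty_bound dL; exists M => u v u0 uv.
apply: prim_norm_lip => //; first exact: Linfty_locint.
apply: (@filterS _ _ (ae_filter_ringOfSetsType _)) dM => s + /andP[us _].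
by apply; rewrite (le_trans u0)// ltW.
Qed.

Theorem sys_iISS : iISS (sys mu gamma).
Proof.
pose c := 2 * f / gamma; have c0 : 0 < c by rewrite divr_gt0// mulr_gt0.
have [k kE] : exists k, k = f / 160 by exists (f / 160).
have k0 : 0 < k by rewrite kE; have := f0; lra.
exists (growth_inv A), (fun r => c * r), (fun s t => decay k (a * s) t).
split; [exact: growth_inv_classKoo| |exact: decay_classKL|].
  split; [|by rewrite mulr0|by move=> r s _ rs; rewrite ltr_pM2l].
  by apply: continuous_subspaceT => r; apply: cvgM; [exact: cvg_cst|exact: cvg_id].
move=> x0 d dL; have ld := Linfty_locint dL.
split; first exact: solution_exists.
move=> x sx t t0; have [x1 [x2 [tr i1 i2 xE]]] := solution_trajectory mu0 ld sx.
have [N PN] := Linfty_prim_lip dL.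
have := lyap_integral_estimate mu0 gamma0 ld tr PN t0.
rewrite i1 i2 -xE// -surjective_pairing -/f -kE -/c => H.
have zx := scaled_lyap_ge0 mu gamma (x t).
have -> : \int[lebesgue_measure]_(s in `[0, t]) (c * `|d s|) = c * prim (fun s => `|d s|) t.
  by rewrite -primZ//; exact: locint_norm.
apply: (@le_trans _ _ (scaled_lyap mu gamma (x t))).
  rewrite -[leRHS](growthK A0 zx); have := enorm_le_growth mu0 gamma0 (x t).
  rewrite le_eqVlt => /predU1P[->//|lt]; apply/ltW/growth_inv_incr => //.
  exact: enorm_ge0.
apply: (le_trans H); rewrite lerD2r.
by apply: decay_scaled_lyap => //; exact: ltW.
Qed.

(** Here w r = sqrt (1280 r / gamma): with a = w^2 <= 1 one has
    prate w >= a / 2, exactly what lyap_gain_estimate requires.  The bound a <= 1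
    is where the smallness of D enters. *)
Theorem sys_ISS (D : R) : 1280 * D <= gamma -> ISS_bounded (sys mu gamma) D.
Proof.
have [k kE] : exists k, k = f / 320 by exists (f / 320).
have k0 : 0 < k by rewrite kE; have := f0; lra.
have [q qE] : exists q, q = 1280 / gamma by exists (1280 / gamma).
have q0 : 0 < q by rewrite qE; have : 0 < gamma^-1 by [rewrite invr_gt0|]; lra.
move=> Dg; have qD : q * D <= 1.
  by rewrite qE mulrAC ler_pdivrMr// mul1r.
have qf : 2 * f / gamma = k * (q / 2).
  by rewrite qE kE; field; rewrite gt_eqF.
pose w (r : R) : R := Num.sqrt (q * r).
pose chi (y : R) : R := growth A (2 * y).
have cchi : continuous chi.
  move=> y; apply: continuous_cvg; first exact: growth_continuous.
  by apply: cvgM; [exact: cvg_cst|exact: cvg_id].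
have chi0 : chi 0 = 0 by rewrite /chi /growth !mulr0 expr0n/= mulr0 addr0 mulr0.
have chi_incr r s : 0 <= r -> r < s -> chi r < chi s.
  by move=> r0 rs; apply: growth_incr => //; lra.
have w0 r : 0 <= w r by exact: sqrtr_ge0.
exists (fun s t => chi (decay k (a * s) t)), (fun r => chi (w r)); split.
- by apply: comp_classKL => //; exact: decay_classKL.
- split.
  + apply: continuous_subspaceT => r; apply: continuous_cvg; first exact: cchi.
    apply: continuous_cvg; first exact: sqrt_continuous.
    by apply: cvgM; [exact: cvg_cst|exact: cvg_id].
  + by rewrite /w mulr0 sqrtr0.
  + move=> r s r0 rs; apply: chi_incr => //.
    by rewrite ltr_sqrt ?ltr_pM2l// mulr_gt0// (le_lt_trans r0).
move=> x0 d dL dD; have ld := Linfty_locint dL.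
split; first exact: solution_exists.
move=> x sx t t0; have [x1 [x2 [tr i1 i2 xE]]] := solution_trajectory mu0 ld sx.
have [N PN] := Linfty_prim_lip dL.
set delta := fine _.
have H : scaled_lyap mu gamma (x t) <=
    decay k (scaled_lyap mu gamma x0) t + w delta.
  have : 0 <= t by []; rewrite le_eqVlt => /predU1P[t00|tpos].
    have -> : x t = x0.
      by rewrite -t00 xE// i1 i2 -surjective_pairing.
    by rewrite -t00 decay0 lerDl.
  have efin := essnorm_half_fin_num tpos dL.
  have eD : (essnorm `[0%R, t[ d <= D%:E)%E.
    apply: le_trans dD; apply: essnorm_subset => s /=.
    by rewrite !in_itv/= => /andP[->].
  have deltaE : (delta%:E = essnorm `[0%R, t[ d)%E by rewrite fineK.
  have deltaD : delta <= D by rewrite -lee_fin deltaE.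
  have delta0 : 0 <= delta.
    rewrite -lee_fin deltaE; apply: essnorm_ge0.
    by rewrite lebesgue_measure_itv/= lte_fin tpos -EFinD lte_fin subr0.
  have := lyap_gain_estimate (delta := delta) mu0 gamma0 ld tr PN t0 (w0 delta).
  rewrite i1 i2 -xE// -surjective_pairing -/f -kE; apply.
    rewrite qf /prate sqr_sqrtr; last by rewrite mulr_ge0// ltW.
    set r := q * delta.
    have r0 : 0 <= r by rewrite mulr_ge0// ltW.
    have r1 : r <= 1 by apply: le_trans qD; rewrite ler_pM2l.
    have -> : k * (q / 2) * delta = k * (r / 2) by rewrite /r; ring.
    by rewrite ler_pM2l// ler_wpM2l// lef_pV2 ?posrE; lra.
  move=> u v u0 uv vt; apply: prim_norm_lip => //.
  have := essnorm_le_ae (lexx (essnorm `[0%R, t[ d)).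
  apply: (@filterS _ _ (ae_filter_ringOfSetsType _)) => s + /andP[us sv].
  rewrite -deltaE lee_fin; apply; rewrite /= in_itv/=.
  by rewrite (le_trans u0 (ltW us)) (le_lt_trans sv vt).
apply: (le_trans (enorm_le_growth mu0 gamma0 (x t))).
have zx := scaled_lyap_ge0 mu gamma (x t).
have kk := ltW k0.
have dz : 0 <= decay k (a * enorm x0) t.
  by apply: decay_ge0 => //; rewrite mulr_ge0 ?enorm_ge0// ltW.
apply: le_trans (growthD (ltW A0) dz (w0 delta)).
apply: growth_homo => //; apply: (le_trans H); rewrite lerD2r.
exact: decay_scaled_lyap.
Qed.

End MainResults.

Theorem theorem3 (R : realType) (mu : R) (hmu : 0 < mu) :
  exists Dbar : R, 0 < Dbar /\
    forall D : R, 0 < D -> D <= Dbar ->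
    forall gamma : R,
      Num.max 4 (2 * D + 4 * Num.sqrt 2 * D `^ (3 / 2)) < gamma ->
      strongly_iISS_with (sys mu gamma) D.
Proof.
(* 1280 D <= 4 < gamma is the bound that sys_ISS requires. *)
exists (1 / 320); split; first lra.
move=> D D0 DD gamma; rewrite gt_max => /andP[g4 _].
have gamma0 : 0 < gamma by lra.
by split; [exact: sys_iISS|apply: sys_ISS => //; lra].
Qed.
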